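(* Let $n\ge 2$ be an integer and consider the piecewise smooth system $$\begin{pmatrix}\dot x\\ \dot y\end{pmatrix}=\begin{cases}\begin{pmatrix}xy+\varepsilon f^+(x,y)\\ \frac32y^2-2x^2+2x+\varepsilon g^+(x,y)\end{pmatrix}, & y>0,\\[3mm] \begin{pmatrix}xy+\varepsilon f^-(x,y)\\ \frac32y^2-2x^2+2x+\varepsilon g^-(x,y)\end{pmatrix}, & y<0,\end{cases}$$ where $0<|\varepsilon|\ll 1$ and $f^\pm(x,y)=\sum_{i+j=0}^n a^\pm_{i,j}x^iy^j$, $g^\pm(x,y)=\sum_{i+j=0}^n b^\pm_{i,j}x^iy^j$ ($i,j\ge 0$) are arbitrary real polynomials of degree at most $n$. Consider the limit cycles of this system bifurcating from the period annulus $\{\Gamma_h : h\in(-1,0)\}$ of the unperturbed system ($\varepsilon=0$). Then, counting multiplicity: (i) if $n=2,3$, the number of limit cycles bifurcating from the period annulus is not more than $40$; (ii) if $4\le n\le 7$, the number of limit cycles bifurcating from the period annulus is not more than $24n-56$; (iii) if $n\ge 8$, the number of limit cycles bifurcating from the period annulus is not more than $22n-64$.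
   Context: The unperturbed system $\dot x=xy,\ \dot y=\frac32y^2-2x^2+2x$ has the first integral $H(x,y)=x^{-3}\big(\frac12y^2-2x^2+x\big)$ with integrating factor $x^{-4}$. It has a center at $(1,0)$, corresponding to $H=-1$. For $h\in(-1,0)$ let $\Gamma_h$ be the closed orbit around $(1,0)$ contained in $\{H=h\}\cap\{x>0\}$; these ovals form the period annulus. Let $\Gamma_h^+=\Gamma_h\cap\{y>0\}$ and $\Gamma_h^-=\Gamma_h\cap\{y<0\}$, oriented by the unperturbed flow (so $\Gamma_h^+$ goes from left to right and $\Gamma_h^-$ from right to left). The first order Melnikov function is $$M(h)=\int_{\Gamma_h^+}x^{-4}\big[g^+dx-f^+dy\big]+\int_{\Gamma_h^-}x^{-4}\big[g^-dx-f^-dy\big],\quad h\in(-1,0).$$ ''The number of limit cycles bifurcating from the period annulus (counting multiplicity)'' is understood at first order in $\varepsilon$, i.e. as the number controlled by $M$: the number of isolated zeros of $M$ in $(-1,0)$, counted with multiplicity. *)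

(* Defs.v *)
From Stdlib Require Import Reals Lra Lia List.
From Coquelicot Require Import Coquelicot.
Open Scope R_scope.

Definition field_x (x y : R) : R := x * y.
Definition field_y (x y : R) : R := 3 / 2 * y ^ 2 - 2 * x ^ 2 + 2 * x.

Definition first_integral (x y : R) : R :=
  (/ 2 * y ^ 2 - 2 * x ^ 2 + x) / x ^ 3.

(* For -1 < h < 0 the whole level set {H = h, x > 0} is the oval around (1,0). *)
Definition oval (h x y : R) : Prop := 0 < x /\ first_integral x y = h.
Definition upper_arc (h x y : R) : Prop := oval h x y /\ 0 < y.
Definition lower_arc (h x y : R) : Prop := oval h x y /\ y < 0.

(* [t |-> (u t, v t)], [a <= t <= b], is a C^1 curve whose restriction to the
   open interval runs through the arc [A] exactly once, in the direction of the
   unperturbed vector field.  The end points of the curve need not be in [A]. *)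
Definition flow_param (A : R -> R -> Prop) (a b : R) (u v : R -> R) : Prop :=
  a < b /\
  (forall t, a <= t <= b ->
     ex_derive u t /\ continuous (Derive u) t /\
     ex_derive v t /\ continuous (Derive v) t) /\
  (forall t, a < t < b ->
     A (u t) (v t) /\
     exists c, 0 < c /\ Derive u t = c * field_x (u t) (v t) /\
                        Derive v t = c * field_y (u t) (v t)) /\
  (forall x y, A x y -> exists! t, a < t < b /\ u t = x /\ v t = y).

(* [I] is the integral of the form P dx + Q dy over the flow-oriented arc [A]. *)
Definition is_line_integral (A : R -> R -> Prop) (P Q : R -> R -> R) (I : R)
  : Prop :=
  exists a b u v, flow_param A a b u v /\
    is_RInt (fun t => P (u t) (v t) * Derive u t + Q (u t) (v t) * Derive v t)
      a b I.

(* The polynomial of degree at most [n] with coefficients [c i j], i + j <= n;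
   [sum_f_R0 f n] is f 0 + ... + f n. *)
Definition poly2 (n : nat) (c : nat -> nat -> R) (x y : R) : R :=
  sum_f_R0 (fun i => sum_f_R0 (fun j => c i j * x ^ i * y ^ j) (n - i)) n.

Definition is_arc_melnikov (A : R -> R -> Prop) (n : nat)
  (a b : nat -> nat -> R) (I : R) : Prop :=
  is_line_integral A (fun x y => / x ^ 4 * poly2 n b x y)
                     (fun x y => - (/ x ^ 4 * poly2 n a x y)) I.

(* [m] is the value at [h] of the first order Melnikov function of the system
   with f^+ = [poly2 n ap], g^+ = [poly2 n bp], f^- = [poly2 n am],
   g^- = [poly2 n bm]. *)
Definition is_melnikov (n : nat) (ap bp am bm : nat -> nat -> R) (h m : R)
  : Prop :=
  exists Ip Im, is_arc_melnikov (upper_arc h) n ap bp Ip /\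
                is_arc_melnikov (lower_arc h) n am bm Im /\ m = Ip + Im.

Definition isolated_zero (M : R -> R) (h : R) : Prop :=
  M h = 0 /\ locally' h (fun t => M t <> 0).

(* [Derive_n] is total, so differentiability up to order [m] is required
   separately. *)
Definition has_order (M : R -> R) (h : R) (m : nat) : Prop :=
  (forall k, (k <= m)%nat -> locally h (ex_derive_n M k)) /\
  (forall k, (k < m)%nat -> Derive_n M k h = 0) /\
  Derive_n M m h <> 0.

(* [M] has finitely many isolated zeros in the open interval (a,b), each of
   finite multiplicity, and the multiplicities add up to at most [N].  The list
   enumerates exactly these zeros, paired with their multiplicities. *)
Definition isolated_zeros_le (M : R -> R) (a b : R) (N : nat) : Prop :=
  exists s : list (R * nat),
    NoDup (map fst s) /\
    (forall h, In h (map fst s) <-> a < h < b /\ isolated_zero M h) /\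
    (forall h m, In (h, m) s -> has_order M h m) /\
    (list_sum (map snd s) <= N)%nat.

(* Existence of the Melnikov function, through an explicit parametrisation of
   the ovals: [melnikov_ex] below. *)

Lemma continuous_poly2 n c (u v : R -> R) t :
  continuous u t -> continuous v t ->
  continuous (fun s => poly2 n c (u s) (v s)) t.
Proof.
intros Hu Hv.
assert (Hpow : forall (f : R -> R) k, continuous f t ->
          continuous (fun s => f s ^ k) t).
{ intros f k Hf; induction k as [|k IH]; simpl.
  - apply continuous_const.
  - apply (continuous_mult f (fun s => f s ^ k)); assumption. }
assert (Hsum : forall (F : nat -> R -> R) k,
          (forall i, continuous (F i) t) ->
          continuous (fun s => sum_f_R0 (fun i => F i s) k) t).
{ intros F k HF; induction k as [|k IH]; simpl.
  - apply HF.
  - apply (continuous_plus (fun s => sum_f_R0 (fun i => F i s) k) (F (S k)));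
      [exact IH | apply HF]. }
unfold poly2.
apply (Hsum (fun i s =>
  sum_f_R0 (fun j => c i j * u s ^ i * v s ^ j) (n - i))); intro i.
apply (Hsum (fun j s => c i j * u s ^ i * v s ^ j)); intro j.
apply (continuous_mult (fun s => c i j * u s ^ i) (fun s => v s ^ j)).
- apply (continuous_mult (fun _ => c i j) (fun s => u s ^ i)).
  + apply continuous_const.
  + apply Hpow, Hu.
- apply Hpow, Hv.
Qed.

Lemma arc_melnikov_ex (A : R -> R -> Prop) n a b t0 t1 u v :
  (forall t, t0 <= t <= t1 -> 0 < u t) -> flow_param A t0 t1 u v ->
  exists I, is_arc_melnikov A n a b I.
Proof.
intros Hpos Hp.
assert (HI : ex_RInt (fun t =>
    / u t ^ 4 * poly2 n b (u t) (v t) * Derive u t +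
    - (/ u t ^ 4 * poly2 n a (u t) (v t)) * Derive v t) t0 t1).
{ destruct Hp as (H01 & HC & _).
  apply (ex_RInt_continuous (V := R_CompleteNormedModule)); intros t Ht.
  rewrite Rmin_left, Rmax_right in Ht by lra.
  destruct (HC t Ht) as (Du & Cu & Dv & Cv).
  assert (Hu : continuous u t) by (apply (ex_derive_continuous (V := R_NormedModule)); exact Du).
  assert (Hv : continuous v t) by (apply (ex_derive_continuous (V := R_NormedModule)); exact Dv).
  assert (Hi : continuous (fun s => / u s ^ 4) t).
  { apply (continuous_comp u (fun x => / x ^ 4)); [exact Hu|].
    apply (ex_derive_continuous (V := R_NormedModule) (fun x => / x ^ 4)).
    specialize (Hpos t Ht); auto_derive.
    assert (0 < u t ^ 4) by (apply pow_lt; assumption); simpl in *; lra. }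
  assert (Hf : forall c, continuous
            (fun s => / u s ^ 4 * poly2 n c (u s) (v s)) t).
  { intro c.
    apply (continuous_mult (fun s => / u s ^ 4)
             (fun s => poly2 n c (u s) (v s))); [exact Hi|].
    apply continuous_poly2; assumption. }
  apply (continuous_plus
    (fun s => / u s ^ 4 * poly2 n b (u s) (v s) * Derive u s)
    (fun s => - (/ u s ^ 4 * poly2 n a (u s) (v s)) * Derive v s)).
  - apply (continuous_mult (fun s => / u s ^ 4 * poly2 n b (u s) (v s))
             (Derive u)); [apply Hf | exact Cu].
  - apply (continuous_mult (fun s => - (/ u s ^ 4 * poly2 n a (u s) (v s)))
             (Derive v)); [|exact Cv].
    apply (continuous_opp (fun s => / u s ^ 4 * poly2 n a (u s) (v s))), Hf. }
destruct HI as [I HI].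
exists I, t0, t1, u, v; split; assumption.
Qed.

Definition oval_x (h t : R) : R := (1 - sqrt (1 + h) * cos t) / - h.
Definition oval_y (h t : R) : R :=
  sqrt (1 + h) * sin t * sqrt (2 * (1 - sqrt (1 + h) * cos t)) / - h.

Lemma oval_x_pos h t : -1 < h < 0 -> 0 < 1 - sqrt (1 + h) * cos t.
Proof.
intros Hh.
assert (H0 : 0 < sqrt (1 + h)) by (apply sqrt_lt_R0; lra).
assert (H1 : sqrt (1 + h) < 1).
{ rewrite <- sqrt_1 at 2; apply sqrt_lt_1; lra. }
destruct (COS_bound t); nra.
Qed.

Lemma oval_x_derive h t : -1 < h < 0 ->
  is_derive (oval_x h) t (sqrt (1 + h) * sin t / - h).
Proof. intros Hh; unfold oval_x; auto_derive; [exact I | field; lra]. Qed.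

Lemma oval_y_derive h t : -1 < h < 0 ->
  is_derive (oval_y h) t
    ((sqrt (1 + h) * cos t * sqrt (2 * (1 - sqrt (1 + h) * cos t)) +
      sqrt (1 + h) * sin t * (sqrt (1 + h) * sin t) /
        sqrt (2 * (1 - sqrt (1 + h) * cos t))) / - h).
Proof.
intros Hh; pose proof (oval_x_pos h t Hh) as Hw.
assert (0 < sqrt (2 * (1 - sqrt (1 + h) * cos t))) by (apply sqrt_lt_R0; lra).
unfold oval_y; auto_derive.
- unfold Rminus in Hw; lra.
- unfold Rminus in *; field; split; lra.
Qed.

Lemma oval_field h t : -1 < h < 0 ->
  exists c, 0 < c /\
    Derive (oval_x h) t = c * field_x (oval_x h t) (oval_y h t) /\
    Derive (oval_y h) t = c * field_y (oval_x h t) (oval_y h t).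
Proof.
intros Hh; pose proof (oval_x_pos h t Hh) as Hw.
rewrite (is_derive_unique _ _ _ (oval_x_derive h t Hh)).
rewrite (is_derive_unique _ _ _ (oval_y_derive h t Hh)).
unfold field_x, field_y, oval_x, oval_y.
assert (Hs : sqrt (1 + h) * sqrt (1 + h) = 1 + h) by (apply sqrt_sqrt; lra).
set (s := sqrt (1 + h)) in *.
set (w := 1 - s * cos t) in *.
assert (Hr : 0 < sqrt (2 * w)) by (apply sqrt_lt_R0; lra).
assert (Hr2 : sqrt (2 * w) * sqrt (2 * w) = 2 * w) by (apply sqrt_sqrt; lra).
set (r := sqrt (2 * w)) in *.
assert (Hss : s * sin t * (s * sin t) = h + 2 * w - w * w).
{ pose proof (sin2_cos2 t) as H; unfold Rsqr in H.
  replace (s * sin t * (s * sin t)) with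
    (s * s * (sin t * sin t + cos t * cos t) - s * cos t * (s * cos t)) by ring.
  rewrite H, Hs; unfold w; ring. }
assert (Hc : s * cos t = 1 - w) by (unfold w; ring).
exists (- h / (w * r)); split; [|split].
- apply Rdiv_lt_0_compat; [lra | apply Rmult_lt_0_compat; assumption].
- field; lra.
- rewrite Hss, Hc.
  replace ((s * sin t * r / - h) ^ 2) with
    (s * sin t * (s * sin t) * (r * r) / (h * h)) by (field; lra).
  rewrite Hss, Hr2.
  apply (Rmult_eq_reg_r (r * (- h))); [|nra].
  replace (((1 - w) * r + (h + 2 * w - w * w) / r) / - h * (r * - h)) with
    ((1 - w) * (r * r) + (h + 2 * w - w * w)) by (field; lra).
  rewrite Hr2; field; lra.
Qed.

Lemma oval_mem h t : -1 < h < 0 -> oval h (oval_x h t) (oval_y h t).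
Proof.
intros Hh; pose proof (oval_x_pos h t Hh) as Hw.
unfold oval, first_integral, oval_x, oval_y.
assert (Hs : sqrt (1 + h) * sqrt (1 + h) = 1 + h) by (apply sqrt_sqrt; lra).
set (s := sqrt (1 + h)) in *.
set (w := 1 - s * cos t) in *.
assert (Hr2 : sqrt (2 * w) * sqrt (2 * w) = 2 * w) by (apply sqrt_sqrt; lra).
set (r := sqrt (2 * w)) in *.
assert (Hss : s * sin t * (s * sin t) = h + 2 * w - w * w).
{ pose proof (sin2_cos2 t) as H; unfold Rsqr in H.
  replace (s * sin t * (s * sin t)) with
    (s * s * (sin t * sin t + cos t * cos t) - s * cos t * (s * cos t)) by ring.
  rewrite H, Hs; unfold w; ring. }
split; [apply Rdiv_lt_0_compat; lra|].
replace ((s * sin t * r / - h) ^ 2) with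
  (s * sin t * (s * sin t) * (r * r) / (h * h)) by (field; lra).
rewrite Hss, Hr2; field; lra.
Qed.

Lemma oval_inv h x y : -1 < h < 0 -> oval h x y -> y <> 0 ->
  exists t, 0 < t < PI /\ x = oval_x h t /\
    (0 < y -> y = oval_y h t) /\ (y < 0 -> y = oval_y h (- t)).
Proof.
intros Hh [Hx HH] Hy.
assert (E : y * y = 2 * x * (h * (x * x) + 2 * x - 1)).
{ unfold first_integral in HH.
  assert (E0 : / 2 * y ^ 2 - 2 * x ^ 2 + x = h * x ^ 3)
    by (rewrite <- HH; field; lra).
  simpl in E0; nra. }
assert (Hs0 : 0 < sqrt (1 + h)) by (apply sqrt_lt_R0; lra).
assert (Hs : sqrt (1 + h) * sqrt (1 + h) = 1 + h) by (apply sqrt_sqrt; lra).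
assert (Hp : 0 < h * (x * x) + 2 * x - 1).
{ assert (0 < y * y) by nra.
  destruct (Rlt_le_dec 0 (h * (x * x) + 2 * x - 1)) as [?|?]; [assumption|nra]. }
assert (Hq : (1 + h * x) * (1 + h * x) < sqrt (1 + h) * sqrt (1 + h)).
{ rewrite Hs; nra. }
assert (Hb : -1 < (1 + h * x) / sqrt (1 + h) < 1).
{ split; [apply Rlt_div_r | apply Rlt_div_l]; nra. }
set (t := acos ((1 + h * x) / sqrt (1 + h))).
assert (Hct : cos t = (1 + h * x) / sqrt (1 + h)) by (apply cos_acos; lra).
assert (Ht : 0 < t < PI) by (apply acos_bound_lt; exact Hb).
assert (Hst : 0 < sin t) by (apply sin_gt_0; lra).
assert (Ex : x = oval_x h t).
{ unfold oval_x; rewrite Hct; field; lra. }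
assert (Hw := oval_x_pos h t Hh).
assert (Hyt : 0 < oval_y h t).
{ unfold oval_y; apply Rdiv_lt_0_compat; [|lra].
  apply Rmult_lt_0_compat; [apply Rmult_lt_0_compat; assumption|].
  apply sqrt_lt_R0; lra. }
assert (Hyn : oval_y h (- t) = - oval_y h t).
{ unfold oval_y; rewrite cos_neg, sin_neg; field; lra. }
assert (E2 : oval_y h t * oval_y h t = y * y).
{ destruct (oval_mem h t Hh) as [_ HM].
  rewrite <- Ex in HM; unfold first_integral in HM.
  assert (E0 : / 2 * oval_y h t ^ 2 - 2 * x ^ 2 + x = h * x ^ 3)
    by (apply (f_equal (fun z => z * x ^ 3)) in HM; rewrite <- HM; field; lra).
  simpl in E0; rewrite E; nra. }
exists t; split; [exact Ht|split; [exact Ex|]].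
rewrite Hyn; split; intro; nra.
Qed.

Lemma oval_x_inj h t t' : -1 < h < 0 -> 0 <= t <= PI -> 0 <= t' <= PI ->
  oval_x h t = oval_x h t' -> t = t'.
Proof.
intros Hh Ht Ht' E.
assert (Hs0 : 0 < sqrt (1 + h)) by (apply sqrt_lt_R0; lra).
apply cos_inj; try lra.
unfold oval_x in E.
assert (E' : 1 - sqrt (1 + h) * cos t = 1 - sqrt (1 + h) * cos t').
{ apply (Rmult_eq_reg_r (/ - h)); [exact E|].
  apply Rinv_neq_0_compat; lra. }
nra.
Qed.

Lemma oval_C1 h t : -1 < h < 0 ->
  ex_derive (oval_x h) t /\ continuous (Derive (oval_x h)) t /\
  ex_derive (oval_y h) t /\ continuous (Derive (oval_y h)) t.
Proof.
intros Hh; pose proof (oval_x_pos h t Hh) as Hw.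
split; [|split; [|split]].
- eexists; apply oval_x_derive, Hh.
- eapply continuous_ext.
  { intro z; symmetry; apply is_derive_unique, oval_x_derive, Hh. }
  apply (ex_derive_continuous (V := R_NormedModule)
    (fun z => sqrt (1 + h) * sin z / - h)); auto_derive; lra.
- eexists; apply oval_y_derive, Hh.
- eapply continuous_ext.
  { intro z; symmetry; apply is_derive_unique, oval_y_derive, Hh. }
  apply (ex_derive_continuous (V := R_NormedModule) (fun z =>
    (sqrt (1 + h) * cos z * sqrt (2 * (1 - sqrt (1 + h) * cos z)) +
      sqrt (1 + h) * sin z * (sqrt (1 + h) * sin z) /
        sqrt (2 * (1 - sqrt (1 + h) * cos z))) / - h)).
  assert (0 < sqrt (2 * (1 - sqrt (1 + h) * cos t))) by (apply sqrt_lt_R0; lra).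
  unfold Rminus in *; auto_derive; repeat split; lra.
Qed.

Lemma upper_flow_param h : -1 < h < 0 ->
  flow_param (upper_arc h) 0 PI (oval_x h) (oval_y h).
Proof.
intros Hh; pose proof PI_RGT_0 as Hpi.
split; [lra|split; [|split]].
- intros t _; apply oval_C1, Hh.
- intros t Ht; split; [split; [apply oval_mem, Hh|]|apply oval_field, Hh].
  unfold oval_y; apply Rdiv_lt_0_compat; [|lra].
  apply Rmult_lt_0_compat; [apply Rmult_lt_0_compat|].
  + apply sqrt_lt_R0; lra.
  + apply sin_gt_0; lra.
  + pose proof (oval_x_pos h t Hh); apply sqrt_lt_R0; lra.
- intros x y [HA Hy].
  destruct (oval_inv h x y Hh HA ltac:(lra)) as (t & Ht & Ex & Ey & _).
  exists t; split; [repeat split; try lra; symmetry; auto|].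
  intros t' (Ht' & Ex' & _); apply (oval_x_inj h); try lra.
Qed.

Lemma lower_flow_param h : -1 < h < 0 ->
  flow_param (lower_arc h) (- PI) 0 (oval_x h) (oval_y h).
Proof.
intros Hh; pose proof PI_RGT_0 as Hpi.
assert (Hxn : forall t, oval_x h (- t) = oval_x h t)
  by (intro t; unfold oval_x; rewrite cos_neg; reflexivity).
split; [lra|split; [|split]].
- intros t _; apply oval_C1, Hh.
- intros t Ht; split; [split; [apply oval_mem, Hh|]|apply oval_field, Hh].
  assert (0 < sqrt (1 + h)) by (apply sqrt_lt_R0; lra).
  assert (0 < sin (- t)) by (apply sin_gt_0; lra).
  assert (0 < sqrt (2 * (1 - sqrt (1 + h) * cos t))).
  { pose proof (oval_x_pos h t Hh); apply sqrt_lt_R0; lra. }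
  assert (0 < - oval_y h t).
  { replace (- oval_y h t) with (sqrt (1 + h) * sin (- t) *
      sqrt (2 * (1 - sqrt (1 + h) * cos t)) / - h)
      by (unfold oval_y; rewrite sin_neg; field; lra).
    apply Rdiv_lt_0_compat; [|lra].
    repeat apply Rmult_lt_0_compat; assumption. }
  lra.
- intros x y [HA Hy].
  destruct (oval_inv h x y Hh HA ltac:(lra)) as (t & Ht & Ex & _ & Ey).
  exists (- t); split; [repeat split; try lra; symmetry; auto|].
  + rewrite Hxn; exact Ex.
  + intros t' (Ht' & Ex' & _).
    assert (t = - t'); [|lra].
    apply (oval_x_inj h); try lra; rewrite Hxn; lra.
Qed.

Lemma melnikov_ex n ap bp am bm h : -1 < h < 0 ->
  exists m, is_melnikov n ap bp am bm h m.
Proof.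
intros Hh.
assert (Hpos : forall t, 0 < oval_x h t).
{ intro t; pose proof (oval_x_pos h t Hh).
  unfold oval_x; apply Rdiv_lt_0_compat; lra. }
destruct (arc_melnikov_ex (upper_arc h) n ap bp 0 PI (oval_x h) (oval_y h)
  (fun t _ => Hpos t) (upper_flow_param h Hh)) as [Ip Hp].
destruct (arc_melnikov_ex (lower_arc h) n am bm (- PI) 0 (oval_x h) (oval_y h)
  (fun t _ => Hpos t) (lower_flow_param h Hh)) as [Im Hm].
exists (Ip + Im), Ip, Im; repeat split; assumption.
Qed.

(* Main.v *)
(* With z = 1 + h, s = sqrt z and w = 1 - s cos t the ovals are parametrised
   explicitly, and every moment of an arc is an integral of a half-integral or an
   integral power of w against a power of s sin t.  Contiguity relations reduce
   the first kind to two complete elliptic integrals U, V with polynomial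
   coefficients, the second kind to s P(z) + B(z) log((1 + s)/(1 - s)) with B of
   degree at most 1.  Two derivatives remove the logarithm; after multiplication
   by a power of z and of 1 - z, the algebraic part is a polynomial, removed by
   further derivatives, and each derivative costs one zero by Rolle's theorem.
   What remains has the zeros of C U + D V.  It satisfies a first order linear
   equation d y' = p y + U r with polynomial coefficients, so that its zeros are
   separated by those of d and r (Khovanskii-Rolle).  The polynomial r does not
   vanish identically because the Riccati equation of V / U has no rational
   solution.  In total this gives 7 n + 11 zeros for n >= 3 (32 for n = 2). *)
Require Import Defs.
From Stdlib Require Import Reals ZArith Lra Lia List Classical Permutation.
From Coquelicot Require Import Coquelicot.
From mathcomp Require all_boot all_order all_algebra ring zify Rstruct.
Open Scope R_scope.

(** * Rational solutions of the Riccati equation *)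

(** The constants come from counting sizes. Let N = n - 3 (N = 0 for n = 2) be the power of 1 - z
    that clears the denominators; C then has degree at most N + 2 and D at most N + 1. Each
    derivative raises both bounds by one. After the 2 derivatives spent on the logarithm and the N +
    4 spent on a polynomial of degree at most N + 3, D has degree less than e = 2 N + 8. In the
    linear equation the coefficient of y' is 4 z (1 - z) D, with at most e + 1 zeros, r has degree
    at most 2 e, and Khovanskii-Rolle adds 1. The sum is (N + 6) + (3 e + 2) = 7 N + 32. The degrees
    stay this low because negative exponents of w cost no more than positive ones: the elliptic
    family has a reflection of q to -q. As for the Riccati equation, a rational solution -C/D would
    have C = E D - 4 z (1 - z) D' with a polynomial E; the conditions at 0, 1 and infinity determine
    E, and then the leading coefficient of D cannot cancel. A separate obstacle is that the arcs may
    be parametrised arbitrarily, so the integrals must first be carried to one fixed curve. *)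

Module RiccatiPoly.
Import all_boot all_order all_algebra ring zify Rstruct.
Import GRing.Theory Num.Theory.
Local Open Scope ring_scope.

Section Riccati.
Variable F : fieldType.
Hypothesis char0 : forall k, k.+1%:R != 0 :> F.
Implicit Types C D E : {poly F}.
Let Dl : {poly F} := 4%:R * 'X * (1 - 'X).

(** Up to the factor -D^2, this is the defect of w = -C/D in the equation Dl w' = - w^2 + 2 (1 - X)
    w - (1 - X) satisfied by V/U. It is also the coefficient of U that remains when V is eliminated
    between C U + D V and its derivative. *)
Definition riccati C D : {poly F} :=
  Dl * (D * C^`() - D^`() * C) - (1 - 'X) * (D * D + 2%:R * D * C) - C * C.

Lemma riccati_scale C D G : riccati (C * G) (D * G) = G * G * riccati C D.
Proof. rewrite /riccati !derivM; ring. Qed.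

Lemma size_1X : size (1 - 'X : {poly F}) = 2%N.
Proof. by rewrite -opprB size_polyN -polyC1 size_XsubC. Qed.

Lemma size_Dl_mul (p : {poly F}) : (size (Dl * p^`())%R <= (size p).+1)%N.
Proof.
have [->|p0] := eqVneq p 0; first by rewrite deriv0 mulr0 size_poly0.
have s3 : (size Dl <= 3)%N.
  rewrite /Dl; apply: (leq_trans (size_polyMleq _ _)).
  rewrite size_1X addn2 /= ltnS.
  apply: (leq_trans (size_polyMleq _ _)); rewrite size_polyX addn2 /= ltnS.
  by rewrite -polyC_natr size_polyC_leq1.
apply: (leq_trans (size_polyMleq _ _)).
have := lt_size_deriv p0; move: s3; lia.
Qed.

(** By coprimality E = (C + Dl D')/D is a polynomial. The equation forces E(1) = 0, E(0) = -1 and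
    degree at most 1, so E = X - 1. What is left is a second order linear equation for D, whose top
    coefficient is (4 d + 3)(4 d + 1) times that of D, with d = deg D. *)
Lemma riccati_coprime C D :
  coprimep C D -> D != 0 -> riccati C D <> 0.
Proof.
move=> cop D0 R0.
have DvC : D %| Dl * D^`() + C.
  have cop' : coprimep D C by rewrite coprimep_sym.
  rewrite -(Gauss_dvdpr _ cop').
  have -> : C * (Dl * D^`() + C) = D * (Dl * C^`() - (1 - 'X) * (D + 2%:R * C)) - riccati C D.
    by rewrite /riccati; ring.
  by rewrite R0 subr0 dvdp_mulr.
have [E EC] := dvdpP _ _ DvC.
have {}EC : C = E * D - Dl * D^`() by rewrite -EC; ring.
(* This is [R0] divided by D, after one factor of C * C is replaced by E D - Dl D'. *)
have H : Dl * C^`() - C * (E + 2%:R * (1 - 'X)) - (1 - 'X) * D = 0.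
  apply: (mulfI D0); rewrite mulr0 -R0 /riccati.
  have -> : C * C = C * (E * D - Dl * D^`()) by rewrite {2}EC.
  by ring.
have X1 : (1 - 'X : {poly F}).[1] = 0 by rewrite hornerD hornerN hornerX hornerC subrr.
(* Modulo 1 - X the equation says C^2 = 0; hence C(1) = 0 and, by coprimality, D(1) is nonzero. *)
have E1 : E.[1] = 0.
  have CC : C * C = (1 - 'X) * (4%:R * 'X * (D * C^`() - D^`() * C) - (D * D + 2%:R * D * C)).
    by apply/eqP; rewrite -subr_eq0 -oppr_eq0 -R0 /riccati /Dl; apply/eqP; ring.
  have /eqP := congr1 (horner^~ 1) CC.
  rewrite /= !hornerM X1 mul0r mulf_eq0 orbb => /eqP C1.
  have D1 : D.[1] != 0 by apply: (coprimep_root cop); apply/rootP.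
  apply: (mulIf D1); rewrite mul0r -hornerM.
  have -> : E * D = C + (1 - 'X) * (4%:R * 'X * D^`()) by rewrite EC /Dl; ring.
  by rewrite hornerD hornerM X1 C1 mul0r addr0.
(* Modulo X the equation says (D + C)^2 = 0, so C(0) = -D(0). *)
have E0 : E.[0] = -1.
  have DC : (D + C) * (D + C) = 'X * (4%:R * (1 - 'X) * (D * C^`() - D^`() * C) + D * D + 2%:R * D * C).
    by apply/eqP; rewrite -subr_eq0 -oppr_eq0 -R0 /riccati /Dl; apply/eqP; ring.
  have /eqP := congr1 (horner^~ 0) DC.
  rewrite /= hornerM (hornerM 'X) hornerX mul0r mulf_eq0 orbb hornerD addr_eq0 => /eqP h.
  have C0 : C.[0] = - D.[0] by rewrite h opprK.
  have D00 : D.[0] != 0.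
    apply/negP => z; have r : root C 0 by rewrite /root C0 oppr_eq0.
    by have := coprimep_root cop r; rewrite z.
  apply: (mulIf D00); rewrite mulN1r -C0 -hornerM.
  have -> : E * D = C + 'X * (4%:R * (1 - 'X) * D^`()) by rewrite EC /Dl; ring.
  by rewrite hornerD (hornerM 'X) hornerX mul0r addr0.
(* If deg E were at least 2, the product C (E + 2 (1 - X)) in [H] would have degree deg C + deg E,
   but the other terms have degree at most deg C + 1. *)
have sE : (size E <= 2)%N.
  rewrite leqNgt; apply/negP => sE.
  have Enz : E != 0 by rewrite -size_poly_gt0; apply: leq_trans sE.
  have sD : (0 < size D)%N by rewrite size_poly_gt0.
  have sED : size (E * D) = (size E + size D).-1 by rewrite size_mul.
  have sC : size C = (size E + size D).-1.
    rewrite EC size_polyDl // size_polyN sED.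
    apply: (leq_ltn_trans (size_Dl_mul D)).
    by case: (size E) sE => [|[|[|k]]] //= _; rewrite addSn /= !addSn !ltnS leq_addl.
  have sE2 : size (E + 2%:R * (1 - 'X)) = size E.
    rewrite size_polyDl //; apply: leq_trans sE; rewrite ltnS.
    rewrite -polyC_natr mul_polyC; apply: (leq_trans (size_scale_leq _ _)).
    by rewrite size_1X.
  have Cnz : C != 0.
    rewrite -size_poly_gt0 sC; case: (size E) sE => [|[|k]] //= _; by rewrite addSn.
  have Enz2 : E + 2%:R * (1 - 'X) != 0 by rewrite -size_poly_gt0 sE2; apply: leq_trans sE.
  have sP : size (C * (E + 2%:R * (1 - 'X))) = (size C + size E).-1 by rewrite size_mul // sE2.
  have : C * (E + 2%:R * (1 - 'X)) = Dl * C^`() - (1 - 'X) * D.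
    by apply/eqP; rewrite -subr_eq0 -oppr_eq0 -H; apply/eqP; ring.
  move/(congr1 (fun p : {poly F} => size p)); rewrite sP => hs.
  have := size_polyD (Dl * C^`()) (- ((1 - 'X) * D)); rewrite -hs size_polyN.
  have s1 := size_Dl_mul C.
  have s2 : (size ((1 - 'X) * D)%R <= (size C).+1)%N.
    by apply: (leq_trans (size_polyMleq _ _)); rewrite size_1X sC; move: (size E) (size D) sE sD; lia.
  have lt c e : (2 < e -> c.+1 < (c + e).-1)%N by lia.
  apply/negP; rewrite -ltnNge gtn_max.
  by rewrite (leq_ltn_trans s1 (lt _ _ sE)) (leq_ltn_trans s2 (lt _ _ sE)).
have EX : E = 'X - 1.
  have EE : E = (E`_0)%:P + E`_1 *: 'X.
    apply/polyP => i; rewrite coefD coefC coefZ coefX.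
    case: i => [|[|i]] /=; rewrite ?mulr0 ?mulr1 ?addr0 ?add0r //.
    by rewrite nth_default //; apply: leq_trans sE _.
  have h0 : E`_0 = -1 by rewrite -horner_coef0.
  move: E1; rewrite EE h0 hornerD hornerC hornerZ hornerX mulr1 addrC => /eqP.
  by rewrite subr_eq0 => /eqP ->; rewrite scale1r polyCN addrC.
have [A defA] : exists A, A = D + 4%:R * 'X * D^`() by exists (D + 4%:R * 'X * D^`()).
have CA : C = ('X - 1) * A by rewrite EC EX defA /Dl; ring.
have HA : 4%:R * 'X * A + 4%:R * 'X * ('X - 1) * A^`() - ('X - 1) * A - D = 0.
  have nz1X : 1 - 'X != 0 :> {poly F} by rewrite -size_poly_gt0 size_1X.
  have C' : C^`() = A + ('X - 1) * A^`().
    have d1 : (1 : {poly F})^`() = 0 by rewrite -polyC1 derivC.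
    by rewrite CA derivM derivB derivX d1; ring.
  by apply: (mulfI nz1X); rewrite mulr0 -H C' CA EX /Dl; ring.
have Dk k : A`_k = (1 + 4%:R * k%:R) * D`_k.
  rewrite defA coefD -mulrA -polyC_natr coefCM coefXM.
  case: k => [|k] /=; first by ring.
  by rewrite coef_deriv -mulr_natl; ring.
have [d sd] : exists d, size D = d.+1.
  by case: (size D) (size_poly_gt0 D) => [|d]; [rewrite D0 | exists d].
(* In degree d + 1 only (4 d + 3) A_d survives, and A_d = (4 d + 1) D_d; neither factor vanishes in
   characteristic 0. *)
have := congr1 (fun p : {poly F} => p`_d.+1) HA.
have -> : 4%:R * 'X * A + 4%:R * 'X * ('X - 1) * A^`() - ('X - 1) * A - D =
  'X * (4%:R%:P * A + 'X * (4%:R%:P * A^`()) - 4%:R%:P * A^`() - A) + A - D.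
  by rewrite polyC_natr; ring.
have Dd : D`_d.+1 = 0 by rewrite nth_default // sd.
have Ad : A`_d.+1 = 0 by rewrite Dk Dd mulr0.
have dA : A^`()`_d = 0 by rewrite coef_deriv Ad mul0rn.
have XdA : ('X * (4%:R%:P * A^`()))`_d = 4%:R * d%:R * A`_d.
  rewrite coefXM; case: (d) => [|k] /=; first by rewrite mulr0 mul0r.
  by rewrite coefCM coef_deriv -mulr_natl; ring.
rewrite !(coefD, coefN) coefXM /= !(coefD, coefN) XdA !coefCM dA Ad Dd coef0.
rewrite mulr0 !subr0 !addr0 Dk => h.
have {}h : (4 * d + 3)%N%:R * ((4 * d + 1)%N%:R * D`_d) = 0 :> F.
  by apply: etrans h; rewrite [(4 * d + 3)%:R]natrD [(4 * d + 1)%:R]natrD natrM; ring.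
move/eqP: h; rewrite !mulf_eq0 addnS addn1 !(negPf (char0 _)) /=.
have -> : D`_d = lead_coef D by rewrite lead_coefE sd.
by rewrite lead_coef_eq0 (negPf D0).
Qed.

(** [riccati] is homogeneous of degree 2 in the pair, so a common factor of C and D can be divided
    out. *)
Lemma riccati_irreducible C D : riccati C D = 0 -> D = 0.
Proof.
move=> R0; apply/eqP; apply/negPn/negP => D0.
have g0 : gcdp C D != 0 by rewrite gcdp_eq0 (negPf D0) andbF.
have C0 := divpK (dvdp_gcdl C D); have DD := divpK (dvdp_gcdr C D).
apply: (@riccati_coprime (C %/ gcdp C D) (D %/ gcdp C D)).
- by apply: coprimep_div_gcd; rewrite D0 orbT.
- by apply: contraNneq D0 => h; rewrite -DD h mul0r.
apply: (mulfI (mulf_neq0 g0 g0)).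
by rewrite mulr0 -riccati_scale C0 DD.
Qed.
End Riccati.
End RiccatiPoly.

(** * Real polynomial functions with a bound on their size *)

Module PolyFun.
Import all_boot all_order all_algebra ring zify Rstruct.
Import GRing.Theory Num.Theory.
Import RiccatiPoly.

(* Indexed by the MathComp size, i.e. degree < n; [pz 0] is the zero function. *)
Definition pz (n : nat) (f : R -> R) : Prop :=
  exists p : {poly R}, (size p <= n)%N /\ forall x, f x = horner p x.

Lemma pz_ext n f g : (forall x, g x = f x) -> pz n f -> pz n g.
Proof. by move=> fg [p [sp fp]]; exists p; split=> // x; rewrite fg. Qed.

Lemma pz_const c : pz 1 (fun _ => c).
Proof.
by exists (polyC c); split; [exact: size_polyC_leq1 | move=> x; rewrite hornerC].
Qed.

Lemma pz_id : pz 2 (fun x => x).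
Proof. by exists (polyX _); split; [rewrite size_polyX | move=> x; rewrite hornerX]. Qed.

Lemma pz_0 f : pz 0 f -> forall x, f x = 0.
Proof.
move=> [p [sp fp]] x; rewrite fp.
by move: sp; rewrite leqn0 size_poly_eq0 => /eqP ->; rewrite horner0.
Qed.

Lemma pz_zero n : pz n (fun _ => 0).
Proof. by exists 0%R; split; [rewrite size_poly0 | move=> x; rewrite horner0]. Qed.

Lemma pz_1 f : pz 1 f -> exists c, forall x, f x = c.
Proof.
move=> [p [sp fp]]; exists (p`_0)%R => x.
by rewrite fp (size1_polyC sp) hornerC coefC.
Qed.

Lemma pz_le m n f : le m n -> pz m f -> pz n f.
Proof. by move=> /leP mn [p [sp fp]]; exists p; split=> //; apply: leq_trans mn. Qed.

Lemma pz_plus n f g : pz n f -> pz n g -> pz n (fun x => f x + g x).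
Proof.
move=> [p [sp fp]] [q [sq gq]]; exists (p + q)%R; split.
  by apply: (leq_trans (size_polyD _ _)); rewrite geq_max sp sq.
by move=> x; rewrite fp gq hornerD.
Qed.

Lemma pz_mult m n f g : pz m f -> pz n g -> pz (Nat.pred (Nat.add m n)) (fun x => f x * g x).
Proof.
move=> [p [sp fp]] [q [sq gq]]; exists (p * q)%R; split.
  apply: (leq_trans (size_polyMleq _ _)); move: sp sq; lia.
by move=> x; rewrite fp gq hornerM.
Qed.

Lemma horner_is_derive (p : {poly R}) x : is_derive (horner p) x (horner (deriv p) x).
Proof.
elim/poly_ind: p => [|p c IH].
  apply: (is_derive_ext (fun=> 0)); first by move=> t; rewrite horner0.
  by rewrite deriv0 horner0; apply: is_derive_const.
apply: (is_derive_ext (fun t => horner p t * t + c)).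
  by move=> t; rewrite hornerMXaddC.
have -> : horner (deriv (p * 'X + c%:P)%R) x = horner (deriv p) x * x + horner p x * 1 + 0.
  rewrite derivD derivM derivX derivC hornerD hornerD horner0 hornerM hornerX.
  by rewrite hornerM hornerC.
apply: is_derive_plus; last exact: is_derive_const.
apply: (is_derive_mult (horner p) (fun t => t)) => //; first exact: is_derive_id.
by move=> a b; apply: Rmult_comm.
Qed.

Lemma pz_deriv n f : pz n f ->
  exists g, pz (Nat.pred n) g /\ forall x, is_derive f x (g x).
Proof.
move=> [p [sp fp]]; exists (horner (deriv p)); split.
  exists (deriv p); split=> //; have [->|p0] := eqVneq p 0%R.
    by rewrite deriv0 size_poly0.
  by have := lt_size_deriv p0; move: sp; lia.
move=> x; apply: (is_derive_ext (horner p)); last exact: horner_is_derive.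
by move=> t; rewrite fp.
Qed.

Lemma horner_eq0 (p : {poly R}) : (forall x, horner p x = 0) -> p = 0%R.
Proof.
move=> p0; apply/eqP; apply/negPn/negP => pn0.
have := max_poly_roots pn0 (rs := [seq (i%:R : R)%R | i <- iota 0 (size p)]).
rewrite size_map size_iota ltnn => H; suff: false by []; apply: H.
  by apply/allP => x _; apply/rootP; apply: p0.
by rewrite map_inj_uniq ?iota_uniq // => i j /eqP; rewrite eqr_nat => /eqP.
Qed.

Lemma pz_eq0_Ioo n f : pz n f -> (forall x, 0 < x < 1 -> f x = 0) -> forall x, f x = 0.
Proof.
move=> [p [_ fp]] f0 x; rewrite fp.
suff -> : p = 0%R by rewrite horner0.
apply/eqP; apply/negPn/negP => pn0.
(* The numbers 1/(i + 2), i < size p, are distinct points of (0,1), one more than a nonzero p can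
   have as roots. *)
have := max_poly_roots pn0 (rs := [seq / (INR i + 2) | i <- iota 0 (size p)]).
rewrite size_map size_iota ltnn => H; suff: false by []; apply: H.
  apply/allP => _ /mapP[i _ ->]; apply/rootP; rewrite -fp; apply: f0.
  have i0 := pos_INR i; split; first by apply: Rinv_0_lt_compat; lra.
  by rewrite -Rinv_1; apply: Rinv_lt_contravar; lra.
rewrite map_inj_uniq ?iota_uniq // => i j /Rinv_eq_reg ij.
by apply: INR_eq; lra.
Qed.

Lemma riccati_fun_irreducible m n (C D C' D' : R -> R) :
  pz m C -> pz n D ->
  (forall x, is_derive C x (C' x)) -> (forall x, is_derive D x (D' x)) ->
  (forall x, 4 * x * (1 - x) * (D x * C' x - D' x * C x)
     - (1 - x) * (D x * D x + 2 * D x * C x) - C x * C x = 0) ->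
  forall x, D x = 0.
Proof.
move=> [p [_ Cp]] [q [_ Dq]] dC dD H.
have C'p x : C' x = horner (deriv p) x.
  rewrite -(is_derive_unique _ _ _ (dC x)); apply: is_derive_unique.
  apply: (is_derive_ext (horner p)); last exact: horner_is_derive.
  by move=> t; rewrite Cp.
have D'q x : D' x = horner (deriv q) x.
  rewrite -(is_derive_unique _ _ _ (dD x)); apply: is_derive_unique.
  apply: (is_derive_ext (horner q)); last exact: horner_is_derive.
  by move=> t; rewrite Dq.
have R0 : riccati _ p q = 0%R.
  apply: horner_eq0 => x; rewrite -[RHS](H x) Cp Dq C'p D'q /riccati -!polyC_natr -polyC1.
  rewrite !(hornerC, hornerX, hornerN, hornerM, hornerD).
  have -> : (2%:R : R)%R = 2 by [].
  have -> : (4%:R : R)%R = 4 by rewrite -[(4%:R)%R]/(1 + (1 + (1 + 1))); lra.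
  by rewrite /Rminus.
move=> x; rewrite Dq (riccati_irreducible _ _ _ _ R0) ?horner0 // => k.
by rewrite pnatr_eq0.
Qed.
End PolyFun.

Import PolyFun.

(** * Smooth functions and their zeros *)

Lemma continuous_primitive a b (f : R -> R) : a < b ->
  (forall x, a <= x <= b -> continuous f x) ->
  exists F : R -> R, forall x, a <= x <= b -> is_derive F x (f x).
Proof.
intros ab Cf.
(* Clamping makes the integrand continuous on the whole line. *)
set (cl := fun x => Rmax a (Rmin x b)).
assert (cl_in : forall x, a <= cl x <= b).
{ intro x; unfold cl; split; [apply Rmax_l|].
  apply Rmax_lub; [lra | apply Rmin_r]. }
assert (cl_id : forall x, a <= x <= b -> cl x = x).
{ intros x Hx; unfold cl; rewrite Rmin_left, Rmax_right; lra. }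
assert (Ccl : forall x, continuous cl x).
(* Minimum and maximum are rewritten with [Rabs], whose continuity [reg] can establish. *)
{ intro x; apply (continuous_ext (fun x => (a + (x + b - Rabs (x - b)) / 2 +
      Rabs ((x + b - Rabs (x - b)) / 2 - a)) / 2)).
  - intro z; unfold cl, Rmax, Rmin.
    destruct (Rle_dec z b); [rewrite (Rabs_left1 (z - b)) by lra |
      rewrite (Rabs_right (z - b)) by lra];
    match goal with |- context [Rle_dec ?u ?v] => destruct (Rle_dec u v) end;
    unfold Rabs; destruct Rcase_abs; lra.
  - apply continuity_pt_filterlim; reg. }
assert (Cfc : forall z, continuous (fun t => f (cl t)) z).
{ intro z; apply (continuous_comp cl f); [apply Ccl | apply Cf, cl_in]. }
exists (fun x => RInt (fun t => f (cl t)) a x); intros x Hx.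
rewrite <- (cl_id x Hx) at 2.
apply (is_derive_RInt (fun t => f (cl t)) _ a x); [|apply Cfc].
exists posreal_one; intros z _; apply (RInt_correct (V := R_CompleteNormedModule)).
apply (ex_RInt_continuous (V := R_CompleteNormedModule)); intros; apply Cfc.
Qed.

Section Smooth.
Variables a b : R.

(** Differentiability of order n by recursion on [Derive]: [Cn_intro] then allows any explicit
    formula valid on (a,b) to stand for the derivative. *)
Fixpoint Cn (n : nat) (f : R -> R) : Prop :=
  match n with
  | O => True
  | S n => (forall x, a < x < b -> ex_derive f x) /\ Cn n (Derive f)
  end.

Definition smooth (f : R -> R) : Prop := forall n, Cn n f.

Lemma locally_Ioo x : a < x < b -> locally x (fun t => a < t < b).
Proof.
intros Hx.
assert (Hd : 0 < Rmin (x - a) (b - x)) by (apply Rmin_glb_lt; lra).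
exists (mkposreal _ Hd); intros y Hy.
apply Rabs_def2 in Hy; unfold minus, plus, opp in Hy; simpl in Hy.
pose proof (Rmin_l (x - a) (b - x)); pose proof (Rmin_r (x - a) (b - x)); lra.
Qed.

Lemma is_derive_ext_Ioo (f g : R -> R) (x l : R) :
  (forall x, a < x < b -> f x = g x) -> a < x < b ->
  is_derive f x l -> is_derive g x l.
Proof.
intros E Hx; apply is_derive_ext_loc.
apply (filter_imp (fun t => a < t < b)); [exact E | apply locally_Ioo, Hx].
Qed.

Lemma Derive_ext_Ioo (f g : R -> R) :
  (forall x, a < x < b -> f x = g x) ->
  forall x, a < x < b -> Derive f x = Derive g x.
Proof.
intros E x Hx; apply Derive_ext_loc.
apply (filter_imp (fun t => a < t < b)); [exact E | apply locally_Ioo, Hx].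
Qed.

Lemma Cn_ext n f g : (forall x, a < x < b -> f x = g x) -> Cn n f -> Cn n g.
Proof.
revert f g; induction n as [|n IH]; intros f g E; [trivial|].
intros [H1 H2]; split.
- intros x Hx; destruct (H1 x Hx) as [l Hl].
  exists l; exact (is_derive_ext_Ioo f g x l E Hx Hl).
- apply (IH (Derive f)); [apply Derive_ext_Ioo, E | exact H2].
Qed.

Lemma Cn_S n f : Cn (S n) f -> Cn n f.
Proof.
revert f; induction n as [|n IH]; intros f [H1 H2]; [exact I|].
split; [exact H1 | apply IH, H2].
Qed.

Lemma Cn_intro n (f g : R -> R) :
  (forall x, a < x < b -> is_derive f x (g x)) -> Cn n g -> Cn (S n) f.
Proof.
intros D C; split.
- intros x Hx; exists (g x); apply D, Hx.
- apply (Cn_ext n g); [|exact C].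
  intros x Hx; symmetry; apply is_derive_unique, D, Hx.
Qed.

Lemma Cn_is_derive n f : Cn (S n) f -> forall x, a < x < b -> is_derive f x (Derive f x).
Proof. intros [H _] x Hx; apply Derive_correct, H, Hx. Qed.

Lemma Cn_const n c : Cn n (fun _ => c).
Proof.
revert c; induction n as [|n IH]; intro c; [exact I|].
apply (Cn_intro _ _ (fun _ => 0)); [|apply IH].
intros x _; apply (is_derive_const c x).
Qed.

Lemma Cn_plus n f g : Cn n f -> Cn n g -> Cn n (fun x => f x + g x).
Proof.
revert f g; induction n as [|n IH]; intros f g Hf Hg; [exact I|].
apply (Cn_intro _ _ (fun x => Derive f x + Derive g x)).
- intros x Hx; apply (is_derive_plus f g x);
    [apply (Cn_is_derive n f) | apply (Cn_is_derive n g)]; assumption.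
- apply IH; [apply Hf | apply Hg].
Qed.

Lemma Cn_mult n f g : Cn n f -> Cn n g -> Cn n (fun x => f x * g x).
Proof.
revert f g; induction n as [|n IH]; intros f g Hf Hg; [exact I|].
apply (Cn_intro _ _ (fun x => Derive f x * g x + f x * Derive g x)).
- intros x Hx; apply (is_derive_mult f g x);
    [apply (Cn_is_derive n f) | apply (Cn_is_derive n g) | intros; apply Rmult_comm];
    assumption.
- apply Cn_plus; apply IH; try apply Hf; try apply Hg; apply Cn_S; assumption.
Qed.

Lemma smooth_ext f g : (forall x, a < x < b -> f x = g x) -> smooth f -> smooth g.
Proof. intros E H n; apply (Cn_ext n f); auto. Qed.

Lemma smooth_const c : smooth (fun _ => c).
Proof. intro n; apply Cn_const. Qed.

Lemma smooth_plus f g : smooth f -> smooth g -> smooth (fun x => f x + g x).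
Proof. intros Hf Hg n; apply Cn_plus; auto. Qed.

Lemma smooth_mult f g : smooth f -> smooth g -> smooth (fun x => f x * g x).
Proof. intros Hf Hg n; apply Cn_mult; auto. Qed.

Lemma smooth_Derive f : smooth f -> smooth (Derive f).
Proof. intros Hf n; apply (Hf (S n)). Qed.

Lemma smooth_is_derive f : smooth f -> forall x, a < x < b -> is_derive f x (Derive f x).
Proof. intros Hf; apply (Cn_is_derive 0), Hf. Qed.

Lemma smooth_continuous f : smooth f -> forall x, a < x < b -> continuous f x.
Proof.
intros Hf x Hx; apply (ex_derive_continuous (V := R_NormedModule)).
exists (Derive f x); apply smooth_is_derive; assumption.
Qed.

Lemma smooth_intro (f g : R -> R) :
  (forall x, a < x < b -> is_derive f x (g x)) -> smooth g -> smooth f.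
Proof. intros D Hg n; apply Cn_S, (Cn_intro n f g D), Hg. Qed.

Lemma smooth_Derive_mult f g x : smooth f -> smooth g -> a < x < b ->
  Derive (fun x => f x * g x) x = Derive f x * g x + f x * Derive g x.
Proof.
intros Hf Hg Hx; apply is_derive_unique.
apply (is_derive_mult f g x); try (apply smooth_is_derive; assumption).
intros; apply Rmult_comm.
Qed.

(* [f] vanishes at [t] to order at least [m]. *)
Fixpoint van (m : nat) (f : R -> R) (t : R) : Prop :=
  match m with
  | O => True
  | S m => f t = 0 /\ van m (Derive f) t
  end.

Lemma van_ext m f g t : (forall x, a < x < b -> f x = g x) -> a < t < b ->
  van m f t -> van m g t.
Proof.
revert f g; induction m as [|m IH]; intros f g E Ht; [trivial|].
intros [H1 H2]; split; [rewrite <- E; assumption|].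
apply (IH (Derive f)); [apply Derive_ext_Ioo, E | exact Ht | exact H2].
Qed.

Lemma van_S m f t : van (S m) f t -> van m f t.
Proof.
revert f; induction m as [|m IH]; intros f [H1 H2]; [exact I|].
split; [exact H1 | apply IH, H2].
Qed.

Lemma van_plus m f g t : smooth f -> smooth g -> a < t < b ->
  van m f t -> van m g t -> van m (fun x => f x + g x) t.
Proof.
revert f g; induction m as [|m IH]; intros f g Hf Hg Ht Vf Vg; [exact I|].
destruct Vf as [Vf0 Vf], Vg as [Vg0 Vg].
split; [lra|].
apply (van_ext m (fun x => Derive f x + Derive g x)); [|exact Ht|].
- intros x Hx; symmetry; apply is_derive_unique.
  apply (is_derive_plus f g x); apply smooth_is_derive; assumption.
- apply IH; auto using smooth_Derive.
Qed.

Lemma van_mult m f g t : smooth f -> smooth g -> a < t < b ->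
  van m f t -> van m (fun x => g x * f x) t.
Proof.
revert f g; induction m as [|m IH]; intros f g Hf Hg Ht Vf; [exact I|].
pose proof (van_S _ _ _ Vf) as Vf'.
destruct Vf as [Vf0 Vf].
split; [rewrite Vf0; ring|].
apply (van_ext m (fun x => Derive g x * f x + g x * Derive f x)); [|exact Ht|].
- intros x Hx; symmetry; apply smooth_Derive_mult; assumption.
- apply van_plus; auto using smooth_Derive, smooth_mult.
Qed.

(** This avoids the smoothness of 1/g: g f' = (g f)' - g' f, and the last term is controlled by the
    order of f obtained first, which is one less than the order wanted. *)
Lemma van_mult_cancel m f g t : smooth f -> smooth g -> a < t < b ->
  g t <> 0 -> van m (fun x => g x * f x) t -> van m f t.
Proof.
revert f g; induction m as [|m IH]; intros f g Hf Hg Ht Gt V; [exact I|].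
assert (Vf : van m f t) by (apply (IH f g); auto; apply van_S, V).
destruct V as [V0 V].
split; [destruct (Rmult_integral _ _ V0); tauto|].
apply (IH (Derive f) g); auto using smooth_Derive.
apply (van_ext m (fun x => Derive (fun y => g y * f y) x + (-1 * Derive g x) * f x)).
- intros x Hx.
  rewrite (smooth_Derive_mult g f x Hg Hf Hx); ring.
- exact Ht.
- apply van_plus; auto using smooth_Derive, smooth_mult, smooth_const.
  apply van_mult; auto using smooth_Derive, smooth_mult, smooth_const.
Qed.

Lemma van_mult_zero m f g t : smooth f -> smooth g -> a < t < b ->
  g t = 0 -> van m f t -> van (S m) (fun x => g x * f x) t.
Proof.
revert f; induction m as [|m IH]; intros f Hf Hg Ht Gt Vf.
{ split; [rewrite Gt; ring | exact I]. }
split; [rewrite Gt; ring|].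
apply (van_ext (S m) (fun x => Derive g x * f x + g x * Derive f x)); [|exact Ht|].
- intros x Hx; symmetry; apply smooth_Derive_mult; assumption.
- apply van_plus; auto using smooth_Derive, smooth_mult.
  + apply van_mult; auto using smooth_Derive.
  + apply IH; auto using smooth_Derive; apply Vf.
Qed.

(* A list of points of [(lo,b)] in increasing order, with lower bounds for the
   orders of vanishing of [f] there. *)
Fixpoint zl (f : R -> R) (lo : R) (l : list (R * nat)) : Prop :=
  match l with
  | nil => True
  | (t, m) :: l => lo < t < b /\ van m f t /\ zl f t l
  end.

Definition weight (l : list (R * nat)) : nat := list_sum (map snd l).

(** Since the listed orders are lower bounds, bounding all lists at once rules out both infinitely
    many zeros and a zero of infinite order. *)
Definition nz (f : R -> R) (k : nat) : Prop :=
  forall l, zl f a l -> (weight l <= k)%nat.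

Lemma zl_lo f lo lo' l : lo' <= lo -> zl f lo l -> zl f lo' l.
Proof.
destruct l as [|[t m] l]; [trivial|]; intros H (H1 & H2 & H3).
repeat split; try tauto; lra.
Qed.

Lemma zl_imp f g lo l : a <= lo ->
  (forall t m, a < t < b -> van m f t -> van m g t) -> zl f lo l -> zl g lo l.
Proof.
intros Hlo H; revert lo Hlo; induction l as [|[t m] l IH]; intros lo Hlo; [trivial|].
intros (H1 & H2 & H3); repeat split; try tauto.
- apply H; [lra | exact H2].
- apply IH; [lra | exact H3].
Qed.

Lemma nz_imp f g k :
  (forall t m, a < t < b -> van m f t -> van m g t) -> nz g k -> nz f k.
Proof. intros H N l Hl; apply N, (zl_imp f); auto with real. Qed.

Lemma nz_le f k k' : (k <= k')%nat -> nz f k -> nz f k'.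
Proof. intros H N l Hl; specialize (N l Hl); lia. Qed.

(** With an integrating factor exp(-P), P' = p/d, the derivative of y exp(-P) is exp(-P) u r / d, so
    Rolle's theorem produces a zero of r. *)
Lemma linear_ode_rolle (y d p u r : R -> R) t1 t2 :
  smooth y -> smooth d -> smooth p -> smooth u ->
  (forall x, a < x < b -> u x <> 0) ->
  (forall x, a < x < b -> d x * Derive y x = p x * y x + u x * r x) ->
  a < t1 -> t1 < t2 -> t2 < b -> y t1 = 0 -> y t2 = 0 ->
  (forall x, t1 <= x <= t2 -> d x <> 0) ->
  exists xi, t1 < xi < t2 /\ r xi = 0.
Proof.
intros Hy HD HS HU U0 E a1 t12 b2 y1 y2 D0.
set (q := fun x => p x / d x).
assert (Cq : forall x, t1 <= x <= t2 -> continuous q x).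
{ intros x Hx; unfold q, Rdiv.
  apply (continuous_mult p (fun x => / d x)).
  - apply smooth_continuous; [exact HS | lra].
  - apply (continuous_comp d (fun z => / z)).
    + apply smooth_continuous; [exact HD | lra].
    + apply (ex_derive_continuous (V := R_NormedModule) (fun z => / z)).
      auto_derive; apply D0, Hx. }
destruct (continuous_primitive t1 t2 q t12 Cq) as [P HP].
destruct (MVT_cor2 (fun x => y x * exp (- P x))
  (fun x => exp (- P x) * (u x * r x / d x)) t1 t2 t12) as (c & Hc & Ic).
- intros x Hx; apply is_derive_Reals.
  pose proof (HP x Hx) as HPx; pose proof (D0 x Hx).
  pose proof (smooth_is_derive y Hy x ltac:(lra)) as Hyx.
  evar_last.
  + apply (is_derive_mult y (fun x => exp (- P x)) x); [exact Hyx | | intros; apply Rmult_comm].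
    apply (is_derive_comp exp (fun x => - P x) x); [apply is_derive_exp|].
    apply (is_derive_opp P x (q x)); exact HPx.
  + unfold plus, mult, scal, opp; simpl; unfold mult; simpl.
    assert (E' := E x ltac:(lra)).
    assert (Derive y x = (p x * y x + u x * r x) / d x) as -> by (rewrite <- E'; field; assumption).
    unfold q; field; assumption.
- exists c; split; [exact Ic|].
  rewrite y1, y2 in Hc.
  assert (d c <> 0) by (apply D0; lra).
  assert (u c <> 0) by (apply U0; lra).
  pose proof (exp_pos (- P c)).
  assert (Hz : exp (- P c) * (u c * r c / d c) * (t2 - t1) = 0) by lra.
  apply Rmult_integral in Hz; destruct Hz as [Hz|]; [|lra].
  apply Rmult_integral in Hz; destruct Hz as [Hz|Hz]; [lra|].
  unfold Rdiv in Hz; apply Rmult_integral in Hz; destruct Hz as [Hz|Hz].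
  + apply Rmult_integral in Hz; tauto.
  + exfalso; revert Hz; apply Rinv_neq_0_compat; assumption.
Qed.

(* Khovanskii-Rolle: between two zeros of [y] lies a zero of [r] or of [d];
   multiplicities are accounted for by reading the equation at the zeros. *)
Lemma linear_ode_zeros (y d p u r : R -> R) kd kr :
  smooth y -> smooth d -> smooth p -> smooth u -> smooth r ->
  (forall x, a < x < b -> u x <> 0) ->
  (forall x, a < x < b -> d x * Derive y x = p x * y x + u x * r x) ->
  nz d kd -> nz r kr -> nz y (kd + kr + 1).
Proof.
intros Hy HD HS HU HR U0 E ND NR.
assert (VR : forall t m, a < t < b -> van m (Derive y) t -> van m y t -> van m r t).
{ intros t m Ht V1 V2.
  apply (van_mult_cancel m r u); auto.
  apply (van_ext m (fun x => d x * Derive y x + (-1 * p x) * y x)); [|exact Ht|].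
  - intros x Hx; rewrite E by exact Hx; ring.
  - apply van_plus; auto using smooth_mult, smooth_Derive, smooth_const.
    + apply van_mult; auto using smooth_Derive.
    + apply van_mult; auto using smooth_mult, smooth_const. }
assert (VR0 : forall t m, a < t < b -> van (S m) y t -> van m r t).
{ intros t m Ht V; apply VR; [exact Ht | apply V | apply van_S, V]. }
(* At a zero of d the factor d restores the order that y' has lost, so r inherits the full order of
   y. *)
assert (VRD : forall t m, a < t < b -> d t = 0 -> van m y t -> van m r t).
{ intros t m Ht Dt V; apply (van_mult_cancel m r u); auto.
  apply (van_ext m (fun x => d x * Derive y x + (-1 * p x) * y x)); [|exact Ht|].
  - intros x Hx; rewrite E by exact Hx; ring.
  - apply van_plus; auto using smooth_mult, smooth_Derive, smooth_const.
    + destruct m as [|m]; [exact I|].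
      apply van_mult_zero; auto using smooth_Derive; apply V.
    + apply van_mult; auto using smooth_mult, smooth_const. }
(* Only points to the right of the zero t are collected. The count may be one short if d t = 0: that
   zero of d pays for the gap to the next zero of y, but it lies at t itself and has to be entered
   by the caller. *)
assert (A : forall l t, a < t < b -> y t = 0 -> zl y t l -> exists l' l'',
  zl r t l' /\ zl d t l'' /\ (weight l <= weight l' + weight l'' + 1)%nat /\
  (d t <> 0 -> (weight l <= weight l' + weight l'')%nat)).
{ induction l as [|[t2 m2] l IH]; intros t Ht yt Hl.
  { exists nil, nil; simpl; unfold weight; simpl; repeat split; lia. }
  destruct Hl as (Ht2 & V2 & Hl).
  destruct m2 as [|m2].
  { destruct (IH t Ht yt) as (l' & l'' & H1 & H2 & H3 & H4).
    { apply (zl_lo y t2); [lra | exact Hl]. }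
    exists l', l''; auto. }
  assert (Ht2' : a < t2 < b) by lra.
  destruct (IH t2 Ht2' (proj1 V2) Hl) as (l' & l'' & H1 & H2 & H3 & H4).
  assert (H1' : forall m, van m r t2 -> zl r t ((t2, m) :: l')).
  { intros m V; repeat split; try lra; assumption. }
  destruct (Req_dec (d t2) 0) as [Dt2|Dt2].
  { exists ((t2, S m2) :: l'), ((t2, 1%nat) :: l''); split; [|split].
    - apply H1', VRD; assumption.
    - repeat split; try lra; assumption.
    - unfold weight in *; simpl in *; split; intros; lia. }
  specialize (H4 Dt2).
  destruct (classic (exists xi, t < xi < t2 /\ d xi = 0)) as [(xi & Hxi & Dxi)|Hno].
  { exists ((t2, m2) :: l'), ((xi, 1%nat) :: l''); split; [|split].
    - apply H1', VR0; assumption.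
    - repeat split; try lra; try assumption.
      apply (zl_lo d t2); [lra | exact H2].
    - unfold weight in *; simpl in *; split; intros; lia. }
  destruct (Req_dec (d t) 0) as [Dt|Dt].
  { exists ((t2, m2) :: l'), l''; split; [|split; [|split]].
    - apply H1', VR0; assumption.
    - apply (zl_lo d t2); [lra | exact H2].
    - unfold weight in *; simpl in *; lia.
    - tauto. }
  destruct (linear_ode_rolle y d p u r t t2) as (xi & Hxi & Rxi); auto; try lra.
  { apply V2. }
  { intros x Hx Dx; destruct (Req_dec x t) as [->|]; [tauto|].
    destruct (Req_dec x t2) as [->|]; [tauto|].
    apply Hno; exists x; split; [lra | exact Dx]. }
  exists ((xi, 1%nat) :: (t2, m2) :: l'), l''; split; [|split].
  - repeat split; try lra; try assumption; apply VR0; assumption.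
  - apply (zl_lo d t2); [lra | exact H2].
  - unfold weight in *; simpl in *; split; intros; lia. }
intros l; induction l as [|[t m] l IH]; intros Hl.
{ unfold weight; simpl; lia. }
destruct Hl as (Ht & V & Hl).
destruct m as [|m].
{ apply IH, (zl_lo y t); [lra | exact Hl]. }
destruct (A l t Ht (proj1 V) Hl) as (l' & l'' & H1 & H2 & H3 & H4).
destruct (Req_dec (d t) 0) as [Dt|Dt].
- assert (NR' : (weight ((t, S m) :: l') <= kr)%nat).
  { apply NR; split; [exact Ht | split; [apply VRD; assumption | exact H1]]. }
  assert (ND' : (weight ((t, 1%nat) :: l'') <= kd)%nat).
  { apply ND; repeat split; tauto. }
  unfold weight in *; simpl in *; lia.
- assert (NR' : (weight ((t, m) :: l') <= kr)%nat).
  { apply NR; split; [exact Ht | split; [apply VR0; assumption | exact H1]]. }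
  assert (ND' : (weight l'' <= kd)%nat) by (apply ND, (zl_lo d t); [lra | exact H2]).
  specialize (H4 Dt); unfold weight in *; simpl in *; lia.
Qed.

(** In a chain of Rolle steps a derivative may vanish identically although its function does not, so
    the degenerate case is carried along. *)
Definition Zb (f : R -> R) (k : nat) : Prop :=
  (forall x, a < x < b -> f x = 0) \/ nz f k.

Lemma Zb_le f k k' : (k <= k')%nat -> Zb f k -> Zb f k'.
Proof. intros H [Z|N]; [left; exact Z | right; apply (nz_le f k); assumption]. Qed.

Lemma Zb_ext f g k : (forall x, a < x < b -> f x = g x) -> Zb f k -> Zb g k.
Proof.
intros E [Z|N]; [left|right].
- intros x Hx; rewrite <- E; auto.
- apply (nz_imp g f); [|exact N].
  intros t m Ht; apply van_ext; [intros; symmetry; auto | exact Ht].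
Qed.

Lemma nz_nonzero f : (forall x, a < x < b -> f x <> 0) -> nz f 0.
Proof.
intros H l; induction l as [|[t m] l IH]; [auto|].
intros (Ht & V & Hl); destruct m as [|m].
- apply IH, (zl_lo f t); [lra | exact Hl].
- destruct V as [V _]; exfalso; apply (H t); assumption.
Qed.

Lemma Zb_mult f g k : smooth f -> smooth g -> (forall x, a < x < b -> g x <> 0) ->
  Zb (fun x => g x * f x) k -> Zb f k.
Proof.
intros Hf Hg G [Z|N]; [left|right].
- intros x Hx; specialize (Z x Hx); simpl in Z.
  apply Rmult_integral in Z; destruct Z as [Z|]; [elim (G x Hx Z) | assumption].
- refine (nz_imp _ _ _ _ N).
  intros t m Ht V; apply van_mult; assumption.
Qed.

(** If the derivative is identically zero, f is constant. Otherwise this is Khovanskii-Rolle with d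
    = u = 1, p = 0 and r = f'. *)
Lemma Zb_rolle f k : smooth f -> Zb (Derive f) k -> Zb f (S k).
Proof.
intros Hf [Z|N].
- destruct (classic (forall x, a < x < b -> f x = 0)) as [H|H]; [left; exact H|right].
  apply (nz_le f 0); [lia|].
  apply nz_nonzero; intros x Hx fx; apply H; intros z Hz.
  destruct (MVT_gen f x z (Derive f)) as (c & Hc & E).
  + intros w Hw; apply smooth_is_derive; [exact Hf|].
    revert Hw; unfold Rmin, Rmax; destruct Rle_dec; lra.
  + intros w Hw; apply continuity_pt_filterlim, smooth_continuous; [exact Hf|].
    revert Hw; unfold Rmin, Rmax; destruct Rle_dec; lra.
  + rewrite Z in E; [lra|].
    revert Hc; unfold Rmin, Rmax; destruct Rle_dec; lra.
- right; replace (S k) with (0 + k + 1)%nat by lia.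
  apply (linear_ode_zeros f (fun _ => 1) (fun _ => 0) (fun _ => 1) (Derive f));
    auto using smooth_const, smooth_Derive.
  + intros; lra.
  + apply nz_nonzero; intros; lra.
Qed.
End Smooth.

(** * From bounds on weighted lists to the exact list of isolated zeros *)

Lemma Derive_n_S f k t : Derive_n f (S k) t = Derive_n (Derive f) k t.
Proof.
change (Derive f) with (Derive_n f 1).
rewrite Derive_n_comp; f_equal; lia.
Qed.

Lemma van_Derive_n m f t : van m f t <-> forall k, (k < m)%nat -> Derive_n f k t = 0.
Proof.
revert f; induction m as [|m IH]; intro f.
- split; [intros _ k Hk; lia | intros _; exact I].
- split.
  + intros [H1 H2] [|k] Hk; [exact H1|].
    rewrite Derive_n_S; apply IH; [exact H2 | lia].
  + intro H; split; [apply (H 0%nat); lia|].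
    apply IH; intros k Hk; rewrite <- Derive_n_S; apply H; lia.
Qed.

Lemma smooth_ex_derive_n a b f k t : smooth a b f -> a < t < b -> ex_derive_n f k t.
Proof.
intros Hf Ht; destruct k as [|k]; [exact I|].
change (ex_derive (Derive_n f k) t).
revert f Hf; induction k as [|k IH]; intros f Hf.
- exists (Derive f t); exact (smooth_is_derive a b f Hf t Ht).
- apply (ex_derive_ext (Derive_n (Derive f) k)).
  + intro z; symmetry; apply Derive_n_S.
  + apply IH, smooth_Derive, Hf.
Qed.

Lemma zl_in b f lo l x : zl b f lo l -> In x (map fst l) -> lo < x < b.
Proof.
revert lo; induction l as [|[t m] l IH]; intros lo; [intros _ []|].
intros (H1 & _ & H3) [<-|H]; [exact H1|].
specialize (IH t H3 H); simpl; lra.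
Qed.

Lemma zl_NoDup b f lo l : zl b f lo l -> NoDup (map fst l).
Proof.
revert lo; induction l as [|[t m] l IH]; intros lo; [constructor|].
intros (H1 & _ & H3); constructor; [|apply (IH t), H3].
intro H; pose proof (zl_in b f t l t H3 H); simpl in *; lra.
Qed.

Lemma zl_van b f lo l t m : zl b f lo l -> In (t, m) l -> van m f t.
Proof.
revert lo; induction l as [|[t' m'] l IH]; intros lo; [intros _ []|].
intros (_ & H2 & H3) [E|H]; [inversion E; subst; exact H2 | apply (IH t'); assumption].
Qed.

Lemma zl_insert b f lo l t m : zl b f lo l -> lo < t < b -> van m f t ->
  ~ In t (map fst l) -> exists l', zl b f lo l' /\ Permutation ((t, m) :: l) l'.
Proof.
revert lo; induction l as [|[t' m'] l IH]; intros lo Hl Ht V Hn.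
- exists ((t, m) :: nil); repeat split; try tauto; apply Permutation_refl.
- destruct Hl as (H1 & H2 & H3).
  destruct (Rtotal_order t t') as [H|[->|H]].
  + exists ((t, m) :: (t', m') :: l); repeat split; try tauto; try lra.
    apply Permutation_refl.
  + elim Hn; left; reflexivity.
  + destruct (IH t' H3) as (l' & Z & P); [lra | exact V | |].
    { intro Hi; apply Hn; right; exact Hi. }
    exists ((t', m') :: l'); split; [repeat split; tauto|].
    eapply Permutation_trans; [apply perm_swap|]; constructor; exact P.
Qed.

(** A zero of infinite order could be listed alone with order k + 1. *)
Lemma nz_finite_order a b f k t : nz a b f k -> a < t < b ->
  exists m, van m f t /\ ~ van (S m) f t.
Proof.
intros N Ht; apply NNPP; intro H.
assert (A : forall m, van m f t).
{ induction m as [|m IH]; [exact I|].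
  apply NNPP; intro Hm; apply H; exists m; tauto. }
specialize (N ((t, S k) :: nil)); unfold weight in N; simpl in N.
assert (S k + 0 <= k)%nat; [|lia].
apply N; split; [exact Ht | split; [apply (A (S k)) | exact I]].
Qed.

(** Starting from the empty list, missing zeros are inserted with their exact orders. Each insertion
    raises the weight by at least 1, so the bound k stops the process; [j] is the room still
    left. *)
Lemma nz_enumeration a b f k : nz a b f k -> exists l, zl b f a l /\
  (forall t m, In (t, m) l -> ~ van (S m) f t) /\
  (forall t, a < t < b -> f t = 0 -> In t (map fst l)) /\
  (forall t m, In (t, m) l -> (1 <= m)%nat).
Proof.
intros N.
assert (A : forall j l, zl b f a l -> (forall t m, In (t, m) l -> ~ van (S m) f t) ->
   (forall t m, In (t, m) l -> (1 <= m)%nat) -> (k < weight l + j)%nat ->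
   exists l, zl b f a l /\
  (forall t m, In (t, m) l -> ~ van (S m) f t) /\
  (forall t, a < t < b -> f t = 0 -> In t (map fst l)) /\
  (forall t m, In (t, m) l -> (1 <= m)%nat)).
{ induction j as [|j IH]; intros l Z O P W.
  { specialize (N l Z); lia. }
  destruct (classic (exists t, (a < t < b /\ f t = 0) /\ ~ In t (map fst l)))
    as [(t & (Ht & ft) & Hn)|Hn].
  - destruct (nz_finite_order a b f k t N Ht) as (m & V & V').
    assert (1 <= m)%nat.
    { destruct m; [|lia]; elim V'; split; [exact ft | exact I]. }
    destruct (zl_insert b f a l t m Z Ht V Hn) as (l' & Z' & Pm).
    apply (IH l' Z').
    + intros t' m' Hi; apply (Permutation_in _ (Permutation_sym Pm)) in Hi.
      destruct Hi as [E|Hi]; [inversion E; subst; exact V' | apply O, Hi].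
    + intros t' m' Hi; apply (Permutation_in _ (Permutation_sym Pm)) in Hi.
      destruct Hi as [E|Hi]; [inversion E; subst; assumption | apply (P t'), Hi].
    + assert (E : weight l' = weight ((t, m) :: l)).
      { unfold weight, list_sum; symmetry.
        apply (Permutation_map snd) in Pm; revert Pm.
        generalize (map snd ((t, m) :: l)), (map snd l'); intros u v Puv.
        induction Puv; simpl; lia. }
      rewrite E; unfold weight in *; simpl; lia.
  - exists l; repeat split; auto.
    intros t Ht ft; apply NNPP; intro Hi; apply Hn; exists t; tauto. }
apply (A (S k) nil); [exact I | intros ? ? [] | intros ? ? [] | unfold weight; simpl; lia].
Qed.

Lemma locally_avoid (l : list R) h :
  locally h (fun t => forall x, In x l -> x <> h -> t <> x).
Proof.
induction l as [|y l IH].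
- apply filter_forall; intros t x [].
- destruct (Req_dec y h) as [->|Hy].
  + apply (filter_imp _ _ ) with (2 := IH).
    intros t H x [<-|Hx] Hn; [tauto | apply H; assumption].
  + assert (Hd : 0 < Rabs (y - h)) by (apply Rabs_pos_lt; lra).
    assert (L : locally h (fun t => t <> y)).
    { exists (mkposreal _ Hd); intros t Ht E; subst t.
      revert Ht; unfold ball; simpl; unfold AbsRing_ball, abs, minus, plus, opp; simpl.
      intro; replace (y + - h) with (y - h) in * by ring; lra. }
    generalize (filter_and _ _ L IH); apply filter_imp.
    intros t [H1 H2] x [<-|Hx] Hn; [exact H1 | apply H2; assumption].
Qed.

(** If f vanishes identically, none of its zeros is isolated and the empty list is correct.
    Otherwise the zeros are finitely many, hence all isolated. *)
Lemma Zb_isolated_zeros_le a b f k : smooth a b f -> Zb a b f k ->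
  isolated_zeros_le f a b k.
Proof.
intros Hf [Z|N].
- exists nil; simpl; split; [constructor|split; [|split]].
  + intro h; split; [tauto|]; intros [Hh [_ L]]; exfalso.
    pose proof (locally_Ioo a b h Hh) as L2.
    destruct (filter_and (F := locally h) _ _ L L2) as [e He].
    assert (0 < e) by apply cond_pos.
    destruct (He (h + e / 2)) as [H1 H2].
    { unfold ball; simpl; unfold AbsRing_ball, abs, minus, plus, opp; simpl.
      replace (h + e / 2 + - h) with (e / 2) by ring; rewrite Rabs_right; lra. }
    apply H1; [lra | apply Z, H2].
  + intros h m [].
  + lia.
- destruct (nz_enumeration a b f k N) as (l & Hl & Ho & Hz & Hm).
  exists l; split; [|split; [|split]].
  + apply (zl_NoDup b f a), Hl.
  + intro h; split.
    * intro Hi; pose proof (zl_in b f a l h Hl Hi) as Hh.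
      split; [exact Hh|split].
      -- apply in_map_iff in Hi; destruct Hi as ([t m] & E & Hi); simpl in E; subst t.
         pose proof (zl_van b f a l h m Hl Hi) as V; specialize (Hm h m Hi).
         destruct m; [lia | apply V].
      -- apply (filter_imp (F := locally h) _ _) with
           (2 := filter_and _ _ (locally_Ioo a b h Hh) (locally_avoid (map fst l) h)).
         intros t [H1 H2] Hn ft.
         apply (H2 t); [apply Hz; assumption | assumption | reflexivity].
    * intros [Hh [fh _]]; apply Hz; assumption.
  + intros h m Hi.
    pose proof (zl_van b f a l h m Hl Hi) as V.
    assert (Hh : a < h < b).
    { apply (zl_in b f a l h Hl), (in_map fst _ _ Hi). }
    split; [|split].
    * intros j _; apply (filter_imp (fun t => a < t < b)); [|apply locally_Ioo, Hh].
      intros t Ht; apply (smooth_ex_derive_n a b); assumption.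
    * apply van_Derive_n, V.
    * intro E; apply (Ho h m Hi), van_Derive_n; intros j Hj.
      destruct (Nat.eq_dec j m) as [->|]; [exact E|].
      apply (proj1 (van_Derive_n m f h) V); lia.
  + apply N, Hl.
Qed.

Lemma isolated_zeros_le_mono f a b k k' : (k <= k')%nat ->
  isolated_zeros_le f a b k -> isolated_zeros_le f a b k'.
Proof.
intros H (s & H1 & H2 & H3 & H4); exists s; repeat split; try apply H1; try apply H2; try apply H3; auto; lia.
Qed.

(** * Independence of the parametrisation of the arcs *)

(** The end points of an arc have angle cosine 1 and -1, where [acos] is not differentiable. It is
    continuous there from both sides because it is extended by the constants 0 and PI. *)
Lemma continuous_acos x : continuous acos x.
Proof.
assert (A : forall x, 1 <= x -> continuous acos x).
{ clear x; intros x Hx.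
  assert (acos1 : forall y, 1 <= y -> acos y = 0).
  { intros y Hy; unfold acos; destruct (Rle_dec y (-1)); [lra|].
    destruct (Rle_dec 1 y); lra. }
  intros P [e He].
  pose proof PI_4; pose proof PI_RGT_0; pose proof PI2_1.
  set (e' := Rmin e 1).
  assert (He' : 0 < e' <= 1).
  { split; [apply Rmin_glb_lt; [apply cond_pos | lra] | apply Rmin_r]. }
  assert (Hc : cos e' < 1) by (rewrite <- cos_0; apply cos_decreasing_1; lra).
  assert (Hd : 0 < 1 - cos e') by lra.
  exists (mkposreal _ Hd); intros y Hy; apply He.
  rewrite (acos1 x Hx).
  apply Rabs_def2 in Hy; unfold minus, plus, opp in Hy; simpl in Hy.
  change (Rabs (acos y - 0) < e); rewrite Rminus_0_r.
  assert (e' <= e) by apply Rmin_l.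
  destruct (Rle_dec 1 y) as [Hy1|Hy1].
  { rewrite (acos1 y Hy1), Rabs_R0; lra. }
  pose proof (acos_bound y) as Hb; rewrite Rabs_right by lra.
  destruct (Rlt_le_dec (acos y) e') as [|Hlt]; [lra|exfalso].
  destruct (COS_bound e').
  assert (cos (acos y) <= cos e') by (apply cos_decr_1; lra).
  rewrite cos_acos in *; lra. }
destruct (Rle_dec 1 x) as [H|H]; [apply A, H|].
destruct (Rle_dec x (-1)) as [H'|H'].
- apply (continuous_ext (fun y => PI - acos (- y))).
  { intro y; rewrite acos_opp; lra. }
  apply (continuous_minus (fun _ => PI) (fun y => acos (- y)) x); [apply continuous_const|].
  apply (continuous_comp Ropp acos x).
  + apply (continuous_opp (fun y : R => y) x), continuous_id.
  + apply A; lra.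
- apply continuity_pt_filterlim, derivable_continuous_pt, derivable_pt_acos; lra.
Qed.

(* [flow_param] with the velocities as explicit functions: [Derive] takes junk
   values where a curve is not differentiable, which does not commute with
   reversing the time. *)
Definition flow_curve (A : R -> R -> Prop) (a b : R) (u v du dv : R -> R) : Prop :=
  a < b /\
  (forall t, a <= t <= b ->
     is_derive u t (du t) /\ continuous du t /\
     is_derive v t (dv t) /\ continuous dv t) /\
  (forall t, a < t < b ->
     A (u t) (v t) /\
     exists c, 0 < c /\ du t = c * field_x (u t) (v t) /\
                        dv t = c * field_y (u t) (v t)) /\
  (forall x y, A x y -> exists! t, a < t < b /\ u t = x /\ v t = y).

Lemma flow_param_curve A a b u v : flow_param A a b u v ->
  flow_curve A a b u v (Derive u) (Derive v).
Proof.
intros (H1 & H2 & H3 & H4); split; [exact H1|split; [|split; assumption]].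
intros t Ht; destruct (H2 t Ht) as (D1 & C1 & D2 & C2).
repeat split; try assumption; apply Derive_correct; assumption.
Qed.

Lemma flow_curve_increasing h a b u v du dv : flow_curve (upper_arc h) a b u v du dv ->
  forall t1 t2, a <= t1 -> t1 < t2 -> t2 <= b -> u t1 < u t2.
Proof.
intros (Hab & HC & HF & _) t1 t2 H1 H12 H2.
destruct (MVT_cor2 u du t1 t2 H12) as (c & Ec & Ic).
- intros t Ht; apply is_derive_Reals, HC; lra.
- destruct (HF c ltac:(lra)) as (((Hx & _) & Hy) & k & Hk & Du & _).
  assert (0 < du c).
  { rewrite Du; unfold field_x; repeat apply Rmult_lt_0_compat; assumption. }
  assert (0 < du c * (t2 - t1)) by (apply Rmult_lt_0_compat; lra).
  lra.
Qed.

Lemma continuous_pos_ball (f : R -> R) x : continuous f x -> 0 < f x ->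
  exists d, 0 < d /\ forall y, Rabs (y - x) < d -> 0 < f y.
Proof.
intros Cf Hf.
assert (L : locally x (fun y => 0 < f y)) by apply Cf, (open_gt 0 (f x) Hf).
destruct L as [d Hd]; exists d; split; [apply cond_pos | exact Hd].
Qed.

(** A parametrisation says nothing directly about where its end points lie. The function (1 + h
    x)/sqrt(1 + h), the cosine of the angle on the oval, is continuous and strictly decreasing along
    the curve and maps the open interval onto (-1,1), so its end values must be 1 and -1. *)
Lemma upper_arc_ends h a b u v du dv : -1 < h < 0 -> flow_curve (upper_arc h) a b u v du dv ->
  (1 + h * u a) / sqrt (1 + h) = 1 /\ (1 + h * u b) / sqrt (1 + h) = -1.
Proof.
intros Hh Hp.
pose proof (flow_curve_increasing h a b u v du dv Hp) as Inc.
destruct Hp as (Hab & HC & HF & HU).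
assert (Hs : 0 < sqrt (1 + h)) by (apply sqrt_lt_R0; lra).
set (s := sqrt (1 + h)) in *.
set (c := fun t => (1 + h * u t) / s).
assert (Hdec : forall t1 t2, a <= t1 -> t1 < t2 -> t2 <= b -> c t2 < c t1).
{ intros t1 t2 H1 H12 H2; pose proof (Inc t1 t2 H1 H12 H2).
  unfold c; apply Rmult_lt_compat_r; [apply Rinv_0_lt_compat, Hs|nra]. }
assert (Hin : forall t, a < t < b -> -1 < c t < 1).
{ intros t Ht; destruct (HF t Ht) as ((Ho & Hy) & _).
  destruct (oval_inv h (u t) (v t) Hh Ho ltac:(lra)) as (th & Hth & Ex & _).
  unfold c; rewrite Ex; unfold oval_x; fold s.
  replace ((1 + h * ((1 - s * cos th) / - h)) / s) with (cos th) by (field; lra).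
  pose proof PI_RGT_0; split.
  - rewrite <- cos_PI; apply cos_decreasing_1; lra.
  - rewrite <- cos_0; apply cos_decreasing_1; lra. }
assert (Hsur : forall m, -1 < m < 1 -> exists t, a < t < b /\ c t = m).
{ intros m Hm; pose proof (acos_bound_lt m Hm) as Hth.
  destruct (HU (oval_x h (acos m)) (oval_y h (acos m))) as (t & (Ht & Ex & _) & _).
  { apply (upper_flow_param h Hh); exact Hth. }
  exists t; split; [exact Ht|].
  unfold c; rewrite Ex; unfold oval_x; fold s; rewrite cos_acos by lra; field; lra. }
assert (Cc : forall t, a <= t <= b -> continuous c t).
{ intros t Ht; apply (ex_derive_continuous (V := R_NormedModule)).
  destruct (HC t Ht) as [Du _]; unfold c; auto_derive; exists (du t); exact Du. }
split.
- change (c a = 1); destruct (Rtotal_order (c a) 1) as [H|[H|H]]; [|exact H|]; exfalso.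
  + destruct (Hsur ((c a + 1) / 2)) as (t & Ht & Et).
    { pose proof (Hin ((a + b) / 2) ltac:(lra)).
      pose proof (Hdec a ((a + b) / 2)); lra. }
    pose proof (Hdec a t); lra.
  + destruct (continuous_pos_ball (fun t => c t - 1) a) as (d & Hd & H1).
    * apply (continuous_minus c (fun _ => 1) a); [apply Cc; lra | apply continuous_const].
    * lra.
    * set (t := a + Rmin (d / 2) ((b - a) / 2)).
      assert (Rmin (d / 2) ((b - a) / 2) <= d / 2) by apply Rmin_l.
      assert (Rmin (d / 2) ((b - a) / 2) <= (b - a) / 2) by apply Rmin_r.
      assert (0 < Rmin (d / 2) ((b - a) / 2)) by (apply Rmin_glb_lt; lra).
      assert (Ht : 0 < c t - 1) by (apply H1; unfold t; rewrite Rabs_right; lra).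
      pose proof (Hin t); unfold t in *; lra.
- change (c b = -1); destruct (Rtotal_order (c b) (-1)) as [H|[H|H]]; [|exact H|]; exfalso.
  + destruct (continuous_pos_ball (fun t => -1 - c t) b) as (d & Hd & H1).
    * apply (continuous_minus (fun _ => -1) c b); [apply continuous_const | apply Cc; lra].
    * lra.
    * set (t := b - Rmin (d / 2) ((b - a) / 2)).
      assert (Rmin (d / 2) ((b - a) / 2) <= d / 2) by apply Rmin_l.
      assert (Rmin (d / 2) ((b - a) / 2) <= (b - a) / 2) by apply Rmin_r.
      assert (0 < Rmin (d / 2) ((b - a) / 2)) by (apply Rmin_glb_lt; lra).
      assert (Ht : 0 < -1 - c t) by (apply H1; unfold t; rewrite Rabs_left; lra).
      pose proof (Hin t); unfold t in *; lra.
  + destruct (Hsur ((c b - 1) / 2)) as (t & Ht & Et).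
    { pose proof (Hin ((a + b) / 2) ltac:(lra)).
      pose proof (Hdec ((a + b) / 2) b); lra. }
    pose proof (Hdec t b); lra.
Qed.

(** The angle [th] along the curve is differentiable only inside the interval, so the substitution
    is made on primitives: if F and G are primitives of the two integrands, F - G(th) has zero
    derivative inside and is continuous up to the ends, hence takes the same value at both. *)
Lemma upper_line_integral h (P Q : R -> R -> R) a b u v du dv I : -1 < h < 0 ->
  (forall (u v : R -> R) t, continuous u t -> continuous v t -> 0 < u t ->
    continuous (fun s => P (u s) (v s)) t /\ continuous (fun s => Q (u s) (v s)) t) ->
  flow_curve (upper_arc h) a b u v du dv ->
  is_RInt (fun t => P (u t) (v t) * du t + Q (u t) (v t) * dv t) a b I ->
  is_RInt (fun t => P (oval_x h t) (oval_y h t) * Derive (oval_x h) t +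
    Q (oval_x h t) (oval_y h t) * Derive (oval_y h) t) 0 PI I.
Proof.
intros Hh HPQ Hp HI.
destruct (upper_arc_ends h a b u v du dv Hh Hp) as [Ea Eb].
pose proof (flow_curve_increasing h a b u v du dv Hp) as Inc.
destruct Hp as (Hab & HC & HF & _).
assert (Hs : 0 < sqrt (1 + h)) by (apply sqrt_lt_R0; lra).
assert (Hs1 : sqrt (1 + h) < 1) by (rewrite <- sqrt_1 at 2; apply sqrt_lt_1; lra).
assert (Cform : forall (x y dx dy : R -> R) t, 0 < x t ->
  is_derive x t (dx t) -> continuous dx t -> is_derive y t (dy t) -> continuous dy t ->
  continuous (fun t => P (x t) (y t) * dx t + Q (x t) (y t) * dy t) t).
{ intros x y dx dy t Hx Dx Cx Dy Cy.
  assert (CX : continuous x t)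
    by (apply (ex_derive_continuous (V := R_NormedModule)); eexists; exact Dx).
  assert (CY : continuous y t)
    by (apply (ex_derive_continuous (V := R_NormedModule)); eexists; exact Dy).
  destruct (HPQ x y t CX CY Hx) as [C1 C2].
  apply (continuous_plus (fun t => P (x t) (y t) * dx t) (fun t => Q (x t) (y t) * dy t)).
  - apply (continuous_mult (fun t => P (x t) (y t)) dx); assumption.
  - apply (continuous_mult (fun t => Q (x t) (y t)) dy); assumption. }
assert (Hua : 0 < u a).
{ assert (1 + h * u a = sqrt (1 + h)) by (replace (1 + h * u a) with ((1 + h * u a) / sqrt (1 + h) * sqrt (1 + h)) by (field; lra); rewrite Ea; ring).
  nra. }
assert (Hu : forall t, a <= t <= b -> 0 < u t).
{ intros t Ht; destruct (Req_dec t a) as [->|]; [exact Hua|].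
  pose proof (Inc a t); lra. }
assert (Hox : forall t, 0 < oval_x h t).
{ intro t; unfold oval_x; pose proof (oval_x_pos h t Hh).
  apply Rdiv_lt_0_compat; lra. }
pose proof PI_RGT_0 as Hpi.
set (f := fun t => P (u t) (v t) * du t + Q (u t) (v t) * dv t) in *.
set (g := fun t => P (oval_x h t) (oval_y h t) * Derive (oval_x h) t +
    Q (oval_x h t) (oval_y h t) * Derive (oval_y h) t).
assert (Cf : forall t, a <= t <= b -> continuous f t).
{ intros t Ht; destruct (HC t Ht) as (D1 & C1 & D2 & C2); apply Cform; auto. }
assert (Cg : forall t, 0 <= t <= PI -> continuous g t).
{ intros t Ht; destruct (oval_C1 h t Hh) as (D1 & C1 & D2 & C2); apply Cform;
  auto using Derive_correct. }
destruct (continuous_primitive a b f Hab Cf) as [F HdF].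
destruct (continuous_primitive 0 PI g Hpi Cg) as [G HdG].
assert (EI : I = F b - F a).
{ rewrite <- (is_RInt_unique _ _ _ _ HI); apply is_RInt_unique.
  apply (is_RInt_derive F f); rewrite Rmin_left, Rmax_right by lra; assumption. }
set (th := fun t => acos ((1 + h * u t) / sqrt (1 + h))).
assert (EFG : F b - G (th b) = F a - G (th a)).
{ destruct (MVT_gen (fun t => F t - G (th t)) a b (fun _ => 0)) as (c & _ & E); [| |lra].
  - rewrite Rmin_left, Rmax_right by lra; intros t Ht.
    destruct (HF t Ht) as ((Ho & Hy) & _).
    destruct (oval_inv h (u t) (v t) Hh Ho ltac:(lra)) as (t0 & Ht0 & Ex & _).
    assert (Hth : forall r, a < r < b -> 0 < th r < PI /\ u r = oval_x h (th r) /\ v r = oval_y h (th r)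
      /\ -1 < (1 + h * u r) / sqrt (1 + h) < 1).
    { clear - HF Hh Hs Hpi th; intros r Hr.
      destruct (HF r Hr) as ((Ho & Hy) & _).
      destruct (oval_inv h (u r) (v r) Hh Ho ltac:(lra)) as (t0 & Ht0 & Ex & Ey & _).
      assert (Ec : (1 + h * u r) / sqrt (1 + h) = cos t0).
      { rewrite Ex; unfold oval_x; field; lra. }
      assert (Et : th r = t0) by (unfold th; rewrite Ec; apply acos_cos; lra).
      rewrite Et, Ec; repeat split; try tauto.
      - rewrite <- cos_PI; apply cos_decreasing_1; lra.
      - rewrite <- cos_0; apply cos_decreasing_1; lra. }
    destruct (HC t ltac:(lra)) as (Du & _ & Dv & _).
    destruct (Hth t Ht) as (Ith & Eu & Ev & Ic).
    assert (Dth : is_derive th t (Derive th t)).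
    { apply Derive_correct; unfold th.
      apply (ex_derive_comp acos (fun t => (1 + h * u t) / sqrt (1 + h))).
      - apply ex_derive_Reals_1, derivable_pt_acos, Ic.
      - auto_derive; exists (du t); exact Du. }
    assert (Hloc : locally t (fun r => a < r < b)).
    { apply (filter_and (fun r => a < r) (fun r => r < b));
        [apply (open_gt a), Ht | apply (open_lt b), Ht]. }
    assert (D1 : du t = Derive th t * Derive (oval_x h) (th t)).
    { rewrite <- (is_derive_unique _ _ _ Du).
      apply is_derive_unique, (is_derive_ext_loc (fun r => oval_x h (th r))).
      - revert Hloc; apply filter_imp; intros r Hr; symmetry; apply Hth, Hr.
      - apply (is_derive_comp (oval_x h) th); [|exact Dth].
        apply Derive_correct, (oval_C1 h _ Hh). }
    assert (D2 : dv t = Derive th t * Derive (oval_y h) (th t)).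
    { rewrite <- (is_derive_unique _ _ _ Dv).
      apply is_derive_unique, (is_derive_ext_loc (fun r => oval_y h (th r))).
      - revert Hloc; apply filter_imp; intros r Hr; symmetry; apply Hth, Hr.
      - apply (is_derive_comp (oval_y h) th); [|exact Dth].
        apply Derive_correct, (oval_C1 h _ Hh). }
    assert (Ef : f t = Derive th t * g (th t)).
    { unfold f, g; rewrite <- Eu, <- Ev, D1, D2; ring. }
    evar_last.
    + apply (is_derive_minus F (fun t => G (th t)) t); [apply HdF; lra|].
      apply (is_derive_comp G th); [apply HdG; lra | exact Dth].
    + unfold minus, plus, opp, scal; simpl; unfold mult; simpl; rewrite Ef; ring.
  - rewrite Rmin_left, Rmax_right by lra; intros t Ht.
    apply continuity_pt_filterlim.
    apply (continuous_minus F (fun t => G (th t)) t).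
    + apply (ex_derive_continuous (V := R_NormedModule)); exists (f t); apply HdF, Ht.
    + apply (continuous_comp th G t).
      * unfold th; apply (continuous_comp (fun t => (1 + h * u t) / sqrt (1 + h)) acos);
          [|apply continuous_acos].
        apply (ex_derive_continuous (V := R_NormedModule)).
        destruct (HC t Ht) as [Du _]; auto_derive; exists (du t); exact Du.
      * apply (ex_derive_continuous (V := R_NormedModule)); exists (g (th t)); apply HdG, acos_bound. }
unfold th in EFG; rewrite Ea, Eb in EFG.
rewrite acos_1 in EFG; replace (-1) with (- (1)) in EFG by ring.
rewrite acos_opp, acos_1, Rminus_0_r in EFG.
replace I with (G PI - G 0) by lra.
apply (is_RInt_derive G g); rewrite Rmin_left, Rmax_right by lra; assumption.
Qed.

(** The unperturbed system is reversible: it is invariant under changing the signs of y and t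
    together, which exchanges the two arcs and preserves their orientation by the flow. *)
Lemma flow_curve_reflect h a b u v du dv : flow_curve (lower_arc h) a b u v du dv ->
  flow_curve (upper_arc h) (- b) (- a) (fun t => u (- t)) (fun t => - v (- t))
    (fun t => - du (- t)) (fun t => dv (- t)).
Proof.
intros (Hab & HC & HF & HU).
assert (Do : forall (f : R -> R) t l, is_derive f (- t) l ->
  is_derive (fun t => f (- t)) t (- l)).
{ intros f t l Hf; evar_last.
  - apply (is_derive_comp f Ropp); [exact Hf|].
    apply (is_derive_opp (fun t : R => t)), (is_derive_id t).
  - unfold scal, opp, one; simpl; unfold mult; simpl; ring. }
assert (Cr : forall (f : R -> R) t, continuous f (- t) -> continuous (fun t => f (- t)) t).
{ intros f t Hf; apply (continuous_comp Ropp f t); [|exact Hf].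
  apply (continuous_opp (fun y : R => y) t), continuous_id. }
split; [lra|split; [|split]].
- intros t Ht; destruct (HC (- t) ltac:(lra)) as (D1 & C1 & D2 & C2).
  split; [apply Do, D1|split; [|split]].
  + apply (continuous_opp (fun t => du (- t)) t), Cr, C1.
  + evar_last; [apply (is_derive_opp (fun t => v (- t)) t), Do, D2|].
    unfold opp; simpl; ring.
  + apply Cr, C2.
- intros t Ht; destruct (HF (- t) ltac:(lra)) as ((Ho & Hy) & c & Hc & E1 & E2).
  split.
  + split; [|lra].
    destruct Ho as [Hx Ho]; split; [exact Hx|].
    rewrite <- Ho; unfold first_integral; f_equal; ring.
  + exists c; split; [exact Hc|].
    rewrite E1, E2; unfold field_x, field_y; split; ring.
- intros x y [[Hx Ho] Hy].
  destruct (HU x (- y)) as (t & (Ht & Eu & Ev) & Hun).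
  { split; [split; [exact Hx|]|lra].
    rewrite <- Ho; unfold first_integral; f_equal; ring. }
  exists (- t); split.
  + rewrite Ropp_involutive; repeat split; lra.
  + intros t' (Ht' & Eu' & Ev').
    rewrite (Hun (- t')); [ring|]; repeat split; lra.
Qed.

Lemma poly2_reflect n c x y :
  poly2 n c x (- y) = poly2 n (fun i j => (-1) ^ j * c i j) x y.
Proof.
unfold poly2; apply sum_eq; intros i _; apply sum_eq; intros j _.
replace (- y) with (-1 * y) by ring; rewrite Rpow_mult_distr; ring.
Qed.

Lemma poly2_scal n k c x y : poly2 n (fun i j => k * c i j) x y = k * poly2 n c x y.
Proof.
unfold poly2; rewrite scal_sum; apply sum_eq; intros i _.
rewrite Rmult_comm, scal_sum; apply sum_eq; intros j _; ring.
Qed.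

Lemma poly2_plus n c c' x y :
  poly2 n (fun i j => c i j + c' i j) x y = poly2 n c x y + poly2 n c' x y.
Proof.
unfold poly2; rewrite <- sum_plus; apply sum_eq; intros i _.
rewrite <- sum_plus; apply sum_eq; intros j _; ring.
Qed.

Lemma continuous_weighted_poly2 n c (u v : R -> R) t :
  continuous u t -> continuous v t -> 0 < u t ->
  continuous (fun s => / u s ^ 4 * poly2 n c (u s) (v s)) t.
Proof.
intros Hu Hv Hp.
apply (continuous_mult (fun s => / u s ^ 4) (fun s => poly2 n c (u s) (v s))).
- apply (continuous_comp u (fun x => / x ^ 4)); [exact Hu|].
  apply (ex_derive_continuous (V := R_NormedModule) (fun x => / x ^ 4)).
  auto_derive; assert (0 < u t ^ 4) by (apply pow_lt; assumption); simpl in *; lra.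
- apply continuous_poly2; assumption.
Qed.

(** * Reduction of the Melnikov function to moments of the upper arc *)

Definition arc_form (n : nat) (a b : nat -> nat -> R) (h t : R) : R :=
  / oval_x h t ^ 4 * poly2 n b (oval_x h t) (oval_y h t) * Derive (oval_x h) t +
  - (/ oval_x h t ^ 4 * poly2 n a (oval_x h t) (oval_y h t)) * Derive (oval_y h) t.

Lemma upper_arc_melnikov n a b h I : -1 < h < 0 ->
  is_arc_melnikov (upper_arc h) n a b I -> is_RInt (arc_form n a b h) 0 PI I.
Proof.
intros Hh (a0 & b0 & u & v & Hp & HI).
apply (upper_line_integral h (fun x y => / x ^ 4 * poly2 n b x y)
   (fun x y => - (/ x ^ 4 * poly2 n a x y)) a0 b0 u v (Derive u) (Derive v)); auto.
- intros x y t Hx Hy Hpos; split; [apply continuous_weighted_poly2; assumption|].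
  apply (continuous_opp (fun s => / x s ^ 4 * poly2 n a (x s) (y s)) t).
  apply continuous_weighted_poly2; assumption.
- apply flow_param_curve, Hp.
Qed.

(** Under the reflection dx/dt changes sign and dy/dt does not. This is why [b] receives a further
    factor -1 besides (-1)^j, and [a] does not. *)
Lemma lower_arc_melnikov n a b h I : -1 < h < 0 ->
  is_arc_melnikov (lower_arc h) n a b I ->
  is_RInt (arc_form n (fun i j => (-1) ^ j * a i j) (fun i j => -1 * ((-1) ^ j * b i j)) h)
    0 PI I.
Proof.
intros Hh (a0 & b0 & u & v & Hp & HI).
apply flow_param_curve, flow_curve_reflect in Hp.
refine (upper_line_integral h
  (fun x y => / x ^ 4 * poly2 n (fun i j => -1 * ((-1) ^ j * b i j)) x y)
  (fun x y => - (/ x ^ 4 * poly2 n (fun i j => (-1) ^ j * a i j) x y))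
  _ _ _ _ _ _ I Hh _ Hp _).
- intros x y t Hx Hy Hpos; split; [apply continuous_weighted_poly2; assumption|].
  apply (continuous_opp (fun s => / x s ^ 4 * poly2 n _ (x s) (y s)) t).
  apply continuous_weighted_poly2; assumption.
- cbv beta; set (f := fun t => _) in HI.
  apply (is_RInt_ext (fun t => opp (opp (f (- t))))).
  + intros t _; rewrite opp_opp; unfold f; rewrite poly2_scal, <- 2!poly2_reflect, Ropp_involutive.
    match goal with |- @eq _ ?x ?y => change (@eq R x y) end; ring.
  + rewrite <- (Ropp_involutive I).
    apply (is_RInt_opp (V := R_NormedModule) (fun t => opp (f (- t))) _ _ (- I)).
    apply (is_RInt_comp_opp f); rewrite !Ropp_involutive.
    apply (is_RInt_swap (V := R_NormedModule) f _ _ I); exact HI.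
Qed.

Lemma melnikov_arc_form n ap bp am bm h m : -1 < h < 0 ->
  is_melnikov n ap bp am bm h m ->
  is_RInt (arc_form n (fun i j => ap i j + (-1) ^ j * am i j)
    (fun i j => bp i j + -1 * ((-1) ^ j * bm i j)) h) 0 PI m.
Proof.
intros Hh (Ip & Im & Hp & Hm & ->).
apply (is_RInt_ext (fun t => plus (arc_form n ap bp h t) (arc_form n (fun i j => (-1) ^ j * am i j)
   (fun i j => -1 * ((-1) ^ j * bm i j)) h t))).
- intros t _; unfold arc_form, plus; simpl; rewrite !poly2_plus; ring.
- apply (is_RInt_plus (V := R_NormedModule)).
  + apply upper_arc_melnikov; assumption.
  + apply lower_arc_melnikov; assumption.
Qed.

(** This is the integral of x^(i-5) y^j dx. The shift is by 5 rather than 4 because integrating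
    x^(i-4) y^j dy by parts leaves x^(i-5) y^(j+1) dx; both kinds of terms then have natural
    indices. *)
Definition arc_moment (h : R) (i j : nat) : R :=
  RInt (fun t => oval_x h t ^ i * oval_y h t ^ j / oval_x h t ^ 5 * Derive (oval_x h) t) 0 PI.

Lemma oval_x_gt_0 h t : -1 < h < 0 -> 0 < oval_x h t.
Proof.
intro Hh; pose proof (oval_x_pos h t Hh); unfold oval_x; apply Rdiv_lt_0_compat; lra.
Qed.

Lemma is_RInt_arc_moment h i j : -1 < h < 0 ->
  is_RInt (fun t => oval_x h t ^ i * oval_y h t ^ j / oval_x h t ^ 5 * Derive (oval_x h) t)
    0 PI (arc_moment h i j).
Proof.
intro Hh; apply (RInt_correct (V := R_CompleteNormedModule)).
apply (ex_RInt_continuous (V := R_CompleteNormedModule)); intros t _.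
destruct (oval_C1 h t Hh) as (D1 & C1 & D2 & _).
apply (continuous_mult (fun t => oval_x h t ^ i * oval_y h t ^ j / oval_x h t ^ 5)); [|exact C1].
apply (ex_derive_continuous (V := R_NormedModule)); auto_derive.
repeat split; try assumption.
apply (pow_nonzero _ 5); pose proof (oval_x_gt_0 h t Hh); lra.
Qed.

Lemma is_derive_pow_quot i x : 0 < x ->
  is_derive (fun x => x ^ i / x ^ 4) x ((INR i - 4) * (x ^ i / x ^ 5)).
Proof.
intro Hx; auto_derive; [apply (pow_nonzero _ 4); lra|].
destruct i as [|i]; [simpl; field; lra|].
rewrite S_INR; simpl; field; lra.
Qed.

(* Integration by parts turns the dy-moments into dx-moments: the ordinate
   vanishes at both ends of the arc. *)
Lemma arc_form_monomial h i j a b : -1 < h < 0 ->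
  is_RInt (fun t => / oval_x h t ^ 4 * (b * oval_x h t ^ i * oval_y h t ^ j) * Derive (oval_x h) t +
    - (/ oval_x h t ^ 4 * (a * oval_x h t ^ i * oval_y h t ^ j)) * Derive (oval_y h) t)
  0 PI (b * arc_moment h (S i) j + a * (INR i - 4) / INR (S j) * arc_moment h i (S j)).
Proof.
intro Hh.
assert (Hj : 0 < INR (S j)) by (apply lt_0_INR; lia).
(* The differential of [W] is the exact form that separates the dy-term from its dx-replacement; it
   integrates to 0. *)
set (W := fun t => - a / INR (S j) * (oval_x h t ^ i / oval_x h t ^ 4 * oval_y h t ^ S j)).
set (W' := fun t => - a / INR (S j) *
  ((INR i - 4) * (oval_x h t ^ i / oval_x h t ^ 5) * Derive (oval_x h) t * oval_y h t ^ S j +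
   oval_x h t ^ i / oval_x h t ^ 4 * (INR (S j) * oval_y h t ^ j * Derive (oval_y h) t))).
assert (HW : is_RInt W' 0 PI 0).
{ replace 0 with (W PI - W 0) at 2.
  - apply (is_RInt_derive (V := R_CompleteNormedModule) W W').
    + intros t _; destruct (oval_C1 h t Hh) as (D1 & _ & D2 & _).
      pose proof (oval_x_gt_0 h t Hh).
      assert (D3 : is_derive (fun t => oval_x h t ^ i / oval_x h t ^ 4) t
         ((INR i - 4) * (oval_x h t ^ i / oval_x h t ^ 5) * Derive (oval_x h) t)).
      { evar_last.
        - apply (is_derive_comp (fun x => x ^ i / x ^ 4) (oval_x h));
            [apply is_derive_pow_quot; assumption | apply Derive_correct, D1].
        - unfold scal; simpl; unfold mult; simpl; ring. }
      assert (D4 : is_derive (fun t => oval_y h t ^ S j) t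
         (INR (S j) * oval_y h t ^ j * Derive (oval_y h) t)).
      { evar_last; [apply (is_derive_pow (oval_y h) (S j) t), Derive_correct, D2|].
        simpl Init.Nat.pred; ring. }
      apply (is_derive_scal (fun t => oval_x h t ^ i / oval_x h t ^ 4 * oval_y h t ^ S j)).
      apply (is_derive_mult (fun t => oval_x h t ^ i / oval_x h t ^ 4) (fun t => oval_y h t ^ S j));
        [exact D3 | exact D4 | intros; apply Rmult_comm].
    + intros t _; destruct (oval_C1 h t Hh) as (D1 & C1 & D2 & C2).
      pose proof (oval_x_gt_0 h t Hh).
      assert (C3 : forall k, continuous (fun t => oval_x h t ^ i / oval_x h t ^ k) t).
      { intro k; apply (ex_derive_continuous (V := R_NormedModule)); auto_derive.
        repeat split; try assumption; apply pow_nonzero; lra. }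
      assert (C4 : forall k, continuous (fun t => oval_y h t ^ k) t).
      { intro k; apply (ex_derive_continuous (V := R_NormedModule)); auto_derive; exact D2. }
      assert (Cm : forall f g : R -> R, continuous f t -> continuous g t ->
        continuous (fun t => f t * g t) t) by (intros f g; apply (continuous_mult f g t)).
      assert (Ck : forall c : R, continuous (fun _ : R => c) t)
        by (intro c; apply continuous_const).
      refine (Cm (fun _ => _) _ (Ck _) (continuous_plus (V := R_NormedModule) _ _ t _ _)).
      * exact (Cm _ _ (Cm _ _ (Cm _ _ (Ck _) (C3 5%nat)) C1) (C4 (S j))).
      * exact (Cm _ _ (C3 4%nat) (Cm _ _ (Cm _ _ (Ck _) (C4 j)) C2)).
  - assert (Y1 : oval_y h PI = 0) by (unfold oval_y; rewrite sin_PI; unfold Rdiv; ring).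
    assert (Y0 : oval_y h 0 = 0) by (unfold oval_y; rewrite sin_0; unfold Rdiv; ring).
    unfold W; rewrite Y1, Y0, <- !tech_pow_Rmult; ring. }
apply (is_RInt_ext (fun t => plus (plus
  (scal b (oval_x h t ^ (S i) * oval_y h t ^ j / oval_x h t ^ 5 * Derive (oval_x h) t))
  (scal (a * (INR i - 4) / INR (S j))
    (oval_x h t ^ i * oval_y h t ^ (S j) / oval_x h t ^ 5 * Derive (oval_x h) t))) (W' t))).
- intros t _; pose proof (oval_x_gt_0 h t Hh).
  unfold W'; set (K := INR (S j)) in *; clearbody K.
  unfold plus, scal; simpl; unfold mult; simpl; field; lra.
- match goal with |- is_RInt _ _ _ ?l => rewrite <- (Rplus_0_r l) end.
  apply (is_RInt_plus (V := R_NormedModule)); [|exact HW].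
  apply (is_RInt_plus (V := R_NormedModule));
  apply (is_RInt_scal (V := R_NormedModule)), is_RInt_arc_moment, Hh.
Qed.

Lemma is_RInt_sum (f : nat -> R -> R) (l : nat -> R) a b n :
  (forall i, is_RInt (f i) a b (l i)) ->
  is_RInt (fun t => sum_f_R0 (fun i => f i t) n) a b (sum_f_R0 l n).
Proof.
intro H; induction n as [|n IH]; simpl; [apply H|].
apply (is_RInt_plus (V := R_NormedModule)); [exact IH | apply H].
Qed.

Lemma arc_form_moments n a b h : -1 < h < 0 ->
  is_RInt (arc_form n a b h) 0 PI
    (sum_f_R0 (fun i => sum_f_R0 (fun j => b i j * arc_moment h (S i) j +
       a i j * (INR i - 4) / INR (S j) * arc_moment h i (S j)) (n - i)) n).
Proof.
intro Hh.
set (F := fun i j t =>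
  / oval_x h t ^ 4 * (b i j * oval_x h t ^ i * oval_y h t ^ j) * Derive (oval_x h) t +
  - (/ oval_x h t ^ 4 * (a i j * oval_x h t ^ i * oval_y h t ^ j)) * Derive (oval_y h) t).
apply (is_RInt_ext (fun t => sum_f_R0 (fun i => sum_f_R0 (fun j => F i j t) (n - i)) n)).
- intros t _; unfold arc_form, poly2.
  set (X := oval_x h t); set (Y := oval_y h t); set (DX := Derive _ t); set (DY := Derive _ t).
  match goal with |- @eq _ ?x ?y => change (@eq R x y) end.
  set (Sb := fun i => sum_f_R0 (fun j => b i j * X ^ i * Y ^ j) (n - i)).
  set (Sa := fun i => sum_f_R0 (fun j => a i j * X ^ i * Y ^ j) (n - i)).
  transitivity (/ X ^ 4 * DX * sum_f_R0 Sb n + - / X ^ 4 * DY * sum_f_R0 Sa n); [|ring].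
  rewrite !scal_sum, <- sum_plus; apply sum_eq; intros i _.
  rewrite (Rmult_comm (Sb i)), (Rmult_comm (Sa i)); unfold Sb, Sa.
  rewrite !scal_sum, <- sum_plus; apply sum_eq; intros j _; unfold F; fold X Y DX DY; ring.
- apply (is_RInt_sum (fun i t => sum_f_R0 (fun j => F i j t) (n - i))); intro i.
  apply (is_RInt_sum (fun j t => F i j t)); intro j.
  apply arc_form_monomial, Hh.
Qed.

(** From here on the coefficients are arbitrary; what matters is that every moment occurring has
    index sum between 1 and n + 1. *)
Lemma melnikov_moments n ap bp am bm : exists a b : nat -> nat -> R,
  forall h m, -1 < h < 0 -> is_melnikov n ap bp am bm h m ->
  m = sum_f_R0 (fun i => sum_f_R0 (fun j => b i j * arc_moment h (S i) j +
       a i j * arc_moment h i (S j)) (n - i)) n.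
Proof.
exists (fun i j => (ap i j + (-1) ^ j * am i j) * (INR i - 4) / INR (S j)),
  (fun i j => bp i j + -1 * ((-1) ^ j * bm i j)).
intros h m Hh Hm; apply melnikov_arc_form in Hm; [|exact Hh].
rewrite <- (is_RInt_unique _ _ _ _ Hm); apply is_RInt_unique.
apply arc_form_moments, Hh.
Qed.

(** * Contiguity relations *)

Definition wz (z t : R) : R := 1 - sqrt z * cos t.

Lemma sqrt_Ioo z : 0 < z < 1 -> 0 < sqrt z < 1.
Proof.
intro Hz; split; [apply sqrt_lt_R0; lra|].
rewrite <- sqrt_1; apply sqrt_lt_1; lra.
Qed.

Lemma wz_pos z t : 0 < z < 1 -> 0 < wz z t.
Proof.
intros Hz; unfold wz; pose proof (sqrt_Ioo z Hz); destruct (COS_bound t); nra.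
Qed.

Lemma sqrt_sin_sqr z t : 0 < z < 1 ->
  (sqrt z * sin t) ^ 2 = (z - 1) + 2 * wz z t - wz z t * wz z t.
Proof.
intros Hz.
assert (Hs : sqrt z * sqrt z = z) by (apply sqrt_sqrt; lra).
pose proof (sin2_cos2 t) as H; unfold Rsqr in H.
replace ((sqrt z * sin t) ^ 2) with
  (sqrt z * sqrt z * (sin t * sin t + cos t * cos t) - sqrt z * cos t * (sqrt z * cos t)) by ring.
rewrite H, Hs; unfold wz; ring.
Qed.

(** The exponents are normalised so that, for m = 0, the elliptic family (k = 0) has its symmetry
    centre at q = 0, and the elementary family (k = 1) is the t-derivative of w^q / q when q is
    nonzero. *)
Definition KI_term (k m : nat) (q : Z) (z t : R) : R :=
  Rpower (wz z t) (IZR q - (1 + INR k) / 2) * (sqrt z * sin t) ^ (2 * m + k).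

(* [k = 0] is the elliptic family, [k = 1] the elementary one. *)
Definition KI (k m : nat) (q : Z) (z : R) : R := RInt (KI_term k m q z) 0 PI.

Lemma continuous_KI_term k m q z t : 0 < z < 1 -> continuous (KI_term k m q z) t.
Proof.
intro Hz; apply (ex_derive_continuous (V := R_NormedModule)).
unfold KI_term, Rpower, wz; auto_derive.
pose proof (wz_pos z t Hz); unfold wz in *; lra.
Qed.

Lemma is_RInt_KI k m q z : 0 < z < 1 -> is_RInt (KI_term k m q z) 0 PI (KI k m q z).
Proof.
intro Hz; apply (RInt_correct (V := R_CompleteNormedModule)).
apply (ex_RInt_continuous (V := R_CompleteNormedModule)); intros t _.
apply continuous_KI_term, Hz.
Qed.

Lemma Rpower_Zsucc w q c : 0 < w -> Rpower w (IZR (q + 1) - c) = Rpower w (IZR q - c) * w.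
Proof.
intro Hw; rewrite plus_IZR; replace (IZR q + 1 - c) with (IZR q - c + 1) by ring.
rewrite Rpower_plus, Rpower_1; [reflexivity | exact Hw].
Qed.

Lemma KI_lower k m q z : 0 < z < 1 ->
  KI k (S m) q z = (z - 1) * KI k m q z + 2 * KI k m (q + 1) z - KI k m (q + 2) z.
Proof.
intro Hz; unfold KI at 1; apply is_RInt_unique.
apply (is_RInt_ext (fun t => minus (plus (scal (z - 1) (KI_term k m q z t))
   (scal 2 (KI_term k m (q + 1) z t))) (KI_term k m (q + 2) z t))).
- intros t _; pose proof (wz_pos z t Hz) as Hw.
  change ((z - 1) * KI_term k m q z t + 2 * KI_term k m (q + 1) z t + - KI_term k m (q + 2) z t
    = KI_term k (S m) q z t); unfold KI_term.
  replace (q + 2)%Z with (q + 1 + 1)%Z by lia.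
  rewrite !Rpower_Zsucc by exact Hw.
  replace (2 * S m + k)%nat with (2 + (2 * m + k))%nat by lia.
  rewrite (pow_add _ 2), sqrt_sin_sqr by exact Hz; ring.
- apply (is_RInt_minus (V := R_NormedModule)); [|apply is_RInt_KI, Hz].
  apply (is_RInt_plus (V := R_NormedModule));
  apply (is_RInt_scal (V := R_NormedModule)), is_RInt_KI, Hz.
Qed.

(** On the oval x = w/(1 - z), y = s sin t sqrt(2 w)/(1 - z) and dx = s sin t dt/(1 - z). The moment
    thus carries (1 - z)^(4-i-j), w^(i-5+j/2) and (s sin t)^(j+1), and the parity of j + 1 selects
    the family k. *)
Lemma arc_moment_KI N i j k m r z : 0 < z < 1 ->
  (j + 1 = 2 * m + k)%nat -> (r + (i + j) = N + 4)%nat ->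
  (1 - z) ^ N * arc_moment (z - 1) i j =
  sqrt 2 ^ j * ((1 - z) ^ r * KI k m (Z.of_nat (i + m + k) - 5) z).
Proof.
intros Hz Hj Hr.
assert (Hh : -1 < z - 1 < 0) by lra.
pose proof (is_RInt_scal (V := R_NormedModule) _ _ _ ((1 - z) ^ N) _ (is_RInt_arc_moment (z - 1) i j Hh)) as H1.
pose proof (is_RInt_scal (V := R_NormedModule) _ _ _ (sqrt 2 ^ j * (1 - z) ^ r) _
  (is_RInt_KI k m (Z.of_nat (i + m + k) - 5) z Hz)) as H2.
rewrite <- Rmult_assoc.
apply (is_RInt_unique (V := R_CompleteNormedModule)) in H1.
apply (is_RInt_unique (V := R_CompleteNormedModule)) in H2.
etransitivity; [symmetry; exact H1|]; etransitivity; [|exact H2].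
apply RInt_ext; intros t _; clear H1 H2.
rewrite (is_derive_unique _ _ _ (oval_x_derive (z - 1) t Hh)).
change ((1 - z) ^ N * (oval_x (z - 1) t ^ i * oval_y (z - 1) t ^ j / oval_x (z - 1) t ^ 5 *
    (sqrt (1 + (z - 1)) * sin t / - (z - 1))) = sqrt 2 ^ j * (1 - z) ^ r *
    KI_term k m (Z.of_nat (i + m + k) - 5) z t); unfold KI_term, oval_x, oval_y.
replace (1 + (z - 1)) with z by ring; replace (- (z - 1)) with (1 - z) by ring.
fold (wz z t); pose proof (wz_pos z t Hz) as Hw.
rewrite sqrt_mult by lra.
set (w := wz z t) in *; set (S := sqrt z * sin t).
assert (E : Rpower w (IZR (Z.of_nat (i + m + k) - 5) - (1 + INR k) / 2) = w ^ i * sqrt w ^ j / w ^ 5).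
{ rewrite minus_IZR, <- INR_IZR_INZ, !plus_INR.
  assert (Hj' : INR j + 1 = 2 * INR m + INR k).
  { change 1 with (INR 1); rewrite <- plus_INR, Hj, plus_INR, mult_INR; simpl; ring. }
  replace (INR i + INR m + INR k - 5 - (1 + INR k) / 2)
    with (INR i + (/ 2 * INR j + - INR 5)) by (simpl; lra).
  rewrite 2!Rpower_plus, Rpower_Ropp, <- Rpower_mult, Rpower_sqrt, !Rpower_pow;
    try exact Hw; try (apply sqrt_lt_R0, Hw); field; lra. }
rewrite E, <- Hj.
assert (Ez : (1 - z) ^ N = (1 - z) ^ r * (1 - z) ^ i * (1 - z) ^ j / (1 - z) ^ 4).
{ apply (Rmult_eq_reg_r ((1 - z) ^ 4)); [|apply pow_nonzero; lra].
  rewrite <- pow_add, <- Hr, !pow_add; field; lra. }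
rewrite Ez; unfold Rdiv; rewrite !Rpow_mult_distr, !pow_inv, pow_add.
assert ((1 - z) ^ i <> 0) by (apply pow_nonzero; lra).
assert ((1 - z) ^ j <> 0) by (apply pow_nonzero; lra).
field; repeat split; lra.
Qed.

Definition KU : R -> R := KI 0 0 0.
Definition KV : R -> R := KI 0 0 1.
Definition KL (z : R) : R := ln (1 + sqrt z) - ln (1 - sqrt z).

Lemma wz_derive_t z t : is_derive (wz z) t (sqrt z * sin t).
Proof. unfold wz; auto_derive; [exact I | ring]. Qed.

Lemma is_derive_Rpower_comp (f : R -> R) c x l : 0 < f x -> is_derive f x l ->
  is_derive (fun x => Rpower (f x) c) x (c * Rpower (f x) (c - 1) * l).
Proof.
intros Hf Df; evar_last.
- apply (is_derive_comp (fun y => Rpower y c) f); [|exact Df].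
  apply is_derive_Reals, derivable_pt_lim_power, Hf.
- unfold scal; simpl; unfold mult; simpl; ring.
Qed.

(** The derivative in t of s sin t w^(q - 1/2) integrates to 0 because the sine vanishes at both
    ends; (s sin t)^2 = z - 1 + 2 w - w^2 turns it into three consecutive powers of w. *)
Lemma KI_recurrence q z : 0 < z < 1 ->
  (IZR q + 1 / 2) * KI 0 0 (q + 1) z =
  2 * IZR q * KI 0 0 q z - (IZR q - 1 / 2) * (1 - z) * KI 0 0 (q - 1) z.
Proof.
intro Hz.
set (c := IZR q - 1 / 2).
set (F := fun t => sqrt z * sin t * Rpower (wz z t) c).
set (F' := fun t => sqrt z * cos t * Rpower (wz z t) c +
  sqrt z * sin t * (c * Rpower (wz z t) (c - 1) * (sqrt z * sin t))).
assert (H0 : is_RInt F' 0 PI 0).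
{ replace 0 with (F PI - F 0) at 2 by (unfold F; rewrite sin_PI, sin_0; ring).
  apply (is_RInt_derive (V := R_CompleteNormedModule) F F').
  - intros t _; pose proof (wz_pos z t Hz).
    apply (is_derive_mult (fun t => sqrt z * sin t) (fun t => Rpower (wz z t) c));
      [ | | intros; apply Rmult_comm].
    + auto_derive; [exact I | ring].
    + apply is_derive_Rpower_comp; [assumption | apply wz_derive_t].
  - intros t _; pose proof (wz_pos z t Hz).
    apply (ex_derive_continuous (V := R_NormedModule)).
    unfold F', Rpower, wz in *; auto_derive; repeat split; lra. }
pose proof (is_RInt_KI 0 0 (q + 1) z Hz) as H1.
pose proof (is_RInt_KI 0 0 q z Hz) as H2.
pose proof (is_RInt_KI 0 0 (q - 1) z Hz) as H3.
pose proof (is_RInt_plus (V := R_NormedModule) _ _ _ _ _ _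
  (is_RInt_scal (V := R_NormedModule) _ _ _ (- (IZR q + 1 / 2)) _ H1)
  (is_RInt_plus (V := R_NormedModule) _ _ _ _ _ _
    (is_RInt_scal (V := R_NormedModule) _ _ _ (2 * IZR q) _ H2)
    (is_RInt_scal (V := R_NormedModule) _ _ _ (- (c * (1 - z))) _ H3))) as H4.
assert (E : - (IZR q + 1 / 2) * KI 0 0 (q + 1) z + (2 * IZR q * KI 0 0 q z +
   - (c * (1 - z)) * KI 0 0 (q - 1) z) = 0).
{ apply (is_RInt_unique (V := R_CompleteNormedModule)) in H4.
  apply (is_RInt_unique (V := R_CompleteNormedModule)) in H0.
  etransitivity; [symmetry; exact H4|]; etransitivity; [|exact H0].
  apply RInt_ext; intros t _.
  change (- (IZR q + 1 / 2) * KI_term 0 0 (q + 1) z t + (2 * IZR q * KI_term 0 0 q z t +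
   - (c * (1 - z)) * KI_term 0 0 (q - 1) z t) = F' t).
  pose proof (wz_pos z t Hz) as Hw.
  unfold KI_term, F'; simpl INR; simpl Nat.mul; simpl Nat.add; rewrite !pow_O.
  replace (IZR q - (1 + 0) / 2) with c by (unfold c; lra).
  replace (IZR (q + 1) - (1 + 0) / 2) with (c - 1 + 1 + 1) by (rewrite plus_IZR; unfold c; lra).
  replace (IZR (q - 1) - (1 + 0) / 2) with (c - 1) by (rewrite minus_IZR; unfold c; lra).
  replace (Rpower (wz z t) c) with (Rpower (wz z t) (c - 1 + 1)) by (f_equal; ring).
  rewrite !Rpower_plus, !Rpower_1 by exact Hw.
  transitivity (Rpower (wz z t) (c - 1) *
    ((1 - wz z t) * wz z t + c * (sqrt z * sin t) ^ 2)).
  - rewrite sqrt_sin_sqr by exact Hz; unfold c; field.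
  - unfold wz; ring. }
unfold c in *; lra.
Qed.

(** Differentiation under the integral sign, where z times the z-derivative of w is (w - 1)/2. *)
Lemma KI_derive q z : 0 < z < 1 ->
  is_derive (KI 0 0 q) z ((IZR q - 1 / 2) / 2 * (KI 0 0 q z - KI 0 0 (q - 1) z) / z).
Proof.
intro Hz.
set (c := IZR q - 1 / 2).
set (df := fun x t => c * Rpower (wz x t) (c - 1) * (- cos t / (2 * sqrt x))).
assert (Df : forall x t, 0 < x < 1 -> is_derive (fun x => KI_term 0 0 q x t) x (df x t)).
{ intros x t Hx; apply (is_derive_ext (fun x => Rpower (wz x t) c)).
  - intro y; unfold KI_term; simpl; rewrite Rmult_1_r; f_equal; unfold c; lra.
  - apply (is_derive_Rpower_comp (fun x => wz x t)); [apply wz_pos, Hx|].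
    pose proof (sqrt_Ioo x Hx).
    unfold wz; auto_derive; [lra | field; lra]. }
assert (E : RInt (fun t => Derive (fun x => KI_term 0 0 q x t) z) 0 PI =
   c / 2 * (KI 0 0 q z - KI 0 0 (q - 1) z) / z).
{ apply (is_RInt_unique (V := R_CompleteNormedModule)).
  apply (is_RInt_ext (fun t => scal (c / 2 / z) (minus (KI_term 0 0 q z t) (KI_term 0 0 (q - 1) z t)))).
  - intros t _; transitivity (df z t); [|symmetry; apply is_derive_unique, Df, Hz].
    change (c / 2 / z * (KI_term 0 0 q z t - KI_term 0 0 (q - 1) z t) = df z t).
    pose proof (wz_pos z t Hz) as Hw; pose proof (sqrt_Ioo z Hz).
    unfold KI_term, df; simpl INR; simpl Nat.mul; simpl Nat.add; rewrite !pow_O.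
    replace (IZR q - (1 + 0) / 2) with (c - 1 + 1) by (unfold c; lra).
    replace (IZR (q - 1) - (1 + 0) / 2) with (c - 1) by (rewrite minus_IZR; unfold c; lra).
    rewrite Rpower_plus, Rpower_1 by exact Hw.
    replace z with (sqrt z * sqrt z) at 1 by (apply sqrt_sqrt; lra).
    transitivity (c / 2 / (sqrt z * sqrt z) * (Rpower (wz z t) (c - 1) * (wz z t - 1))); [ring|].
    replace (wz z t - 1) with (- (sqrt z * cos t)) by (unfold wz; ring).
    field; lra.
  - replace (c / 2 * (KI 0 0 q z - KI 0 0 (q - 1) z) / z)
      with (c / 2 / z * (KI 0 0 q z - KI 0 0 (q - 1) z)) by (field; lra).
    apply (is_RInt_scal (V := R_NormedModule)), (is_RInt_minus (V := R_NormedModule));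
    apply is_RInt_KI, Hz. }
rewrite <- E.
apply (is_derive_RInt_param (fun x t => KI_term 0 0 q x t) 0 PI z).
- apply (filter_imp (fun x => 0 < x < 1)); [|apply locally_Ioo, Hz].
  intros x Hx t _; eexists; apply Df, Hx.
- intros t _.
  apply (continuity_2d_pt_ext_loc df).
  + destruct (locally_Ioo 0 1 z Hz) as [d Hd]; exists d; intros u v Hu _.
    symmetry; apply is_derive_unique, Df, Hd, Hu.
  + pose proof (wz_pos z t Hz); pose proof (sqrt_Ioo z Hz).
    assert (Csqrt : continuity_2d_pt (fun u _ => sqrt u) z t).
    { apply (continuity_1d_2d_pt_comp sqrt (fun u _ => u));
        [apply continuity_pt_sqrt; lra | apply continuity_2d_pt_id1]. }
    assert (Ccos : continuity_2d_pt (fun _ v => cos v) z t).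
    { apply (continuity_1d_2d_pt_comp cos (fun _ v => v));
        [apply continuity_cos | apply continuity_2d_pt_id2]. }
    unfold df; apply continuity_2d_pt_mult; [apply continuity_2d_pt_mult|].
    * apply continuity_2d_pt_const.
    * apply (continuity_1d_2d_pt_comp (fun w => Rpower w (c - 1)) (fun u v => wz u v)).
      -- apply derivable_continuous_pt; exists ((c - 1) * Rpower (wz z t) (c - 1 - 1)).
         apply derivable_pt_lim_power; assumption.
      -- unfold wz; apply continuity_2d_pt_minus; [apply continuity_2d_pt_const|].
         apply continuity_2d_pt_mult; assumption.
    * unfold Rdiv; apply continuity_2d_pt_mult; [apply continuity_2d_pt_opp; exact Ccos|].
      apply continuity_2d_pt_inv; [|lra].
      apply continuity_2d_pt_mult; [apply continuity_2d_pt_const | exact Csqrt].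
- apply (filter_imp (fun x => 0 < x < 1)); [|apply locally_Ioo, Hz].
  intros x Hx; eexists; apply is_RInt_KI, Hx.
Qed.

Lemma KU_derive z : 0 < z < 1 ->
  is_derive KU z ((KV z - (1 - z) * KU z) / (4 * z * (1 - z))).
Proof.
intro Hz; evar_last; [apply (KI_derive 0), Hz|].
pose proof (KI_recurrence 0 z Hz) as E; simpl Z.add in E; simpl Z.sub in *.
unfold KU, KV.
(* At q = 0 the middle term of the recurrence vanishes. *)
assert (KI 0 0 (-1) z = KI 0 0 1 z / (1 - z)) as -> by (apply (Rmult_eq_reg_r (1 - z)); [field_simplify; lra | lra]).
field; lra.
Qed.

Lemma KV_derive z : 0 < z < 1 -> is_derive KV z ((KV z - KU z) / (4 * z)).
Proof.
intro Hz; evar_last; [apply (KI_derive 1), Hz|].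
simpl Z.sub; unfold KU, KV; field; lra.
Qed.

Lemma KU_pos z : 0 < z < 1 -> 0 < KU z.
Proof.
intro Hz; apply RInt_gt_0; [apply PI_RGT_0 | |].
- intros t _; unfold KI_term, Rpower; simpl; rewrite Rmult_1_r; apply exp_pos.
- intros t _; apply continuous_KI_term, Hz.
Qed.

(** The three-term recurrence is carried to itself by q to -q up to powers of 1 - z, and the first
    two cases agree. For the exponent v = q - 1/2 of w this is the Legendre symmetry of v and -v -
    1. *)
Lemma KI_0_symmetry k z : 0 < z < 1 ->
  (1 - z) ^ k * KI 0 0 (- Z.of_nat k) z = KI 0 0 (Z.of_nat k) z.
Proof.
intro Hz; enough (H : (1 - z) ^ k * KI 0 0 (- Z.of_nat k) z = KI 0 0 (Z.of_nat k) z /\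
  (1 - z) ^ S k * KI 0 0 (- Z.of_nat (S k)) z = KI 0 0 (Z.of_nat (S k)) z) by apply H.
induction k as [|k [IH1 IH2]].
- split; [simpl; ring|].
  pose proof (KI_recurrence 0 z Hz) as E; simpl in E |- *; lra.
- split; [exact IH2|].
  pose proof (KI_recurrence (Z.of_nat (S k)) z Hz) as E1.
  pose proof (KI_recurrence (- Z.of_nat (S k)) z Hz) as E2.
  replace (Z.of_nat (S k) + 1)%Z with (Z.of_nat (S (S k))) in E1 by lia.
  replace (Z.of_nat (S k) - 1)%Z with (Z.of_nat k) in E1 by lia.
  replace (- Z.of_nat (S k) + 1)%Z with (- Z.of_nat k)%Z in E2 by lia.
  replace (- Z.of_nat (S k) - 1)%Z with (- Z.of_nat (S (S k)))%Z in E2 by lia.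
  rewrite opp_IZR in E2.
  assert (Hk : 0 < IZR (Z.of_nat (S k))) by (apply IZR_lt; lia).
  set (c := IZR (Z.of_nat (S k))) in *.
  apply (Rmult_eq_reg_l (c + 1 / 2)); [|lra].
  rewrite E1, <- IH2, <- IH1.
  apply (f_equal (fun x => (1 - z) ^ S k * x)) in E2.
  simpl in E2 |- *; lra.
Qed.

(** * Degree bounds for the reduced moments *)

Lemma pz_scal n c f : pz n f -> pz n (fun x => c * f x).
Proof.
intro Hf; apply (pz_le (Nat.pred (1 + n)) n); [simpl; lia|].
apply (pz_mult 1 n (fun _ => c)); [apply pz_const | exact Hf].
Qed.

Lemma pz_1mX : pz 2 (fun x => 1 - x).
Proof.
apply (pz_ext 2 (fun x => 1 + -1 * x)); [intro; ring|].
apply pz_plus; [apply (pz_le 1); [lia | apply pz_const] | apply pz_scal, pz_id].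
Qed.

Lemma pz_1mX_pow r n f : pz n f -> pz (n + r) (fun x => (1 - x) ^ r * f x).
Proof.
intro Hf; induction r as [|r IH].
- rewrite Nat.add_0_r; apply (pz_ext n f); [intro; simpl; ring | exact Hf].
- apply (pz_ext _ (fun x => (1 - x) * ((1 - x) ^ r * f x))); [intro; simpl; ring|].
  apply (pz_le (Nat.pred (2 + (n + r)))); [lia|].
  apply pz_mult; [apply pz_1mX | exact IH].
Qed.

Lemma pz_lin n c d f g : pz n f -> pz n g -> pz n (fun x => c * f x + d * g x).
Proof. intros Hf Hg; apply pz_plus; apply pz_scal; assumption. Qed.

(* The weight [w] is twice the growth exponent at infinity, [KV] having
   exponent 1/2 relatively to [KU]. *)
Definition elliptic_class (w : nat) (f : R -> R) : Prop :=
  exists C D, pz (w / 2 + 1) C /\ pz ((w + 1) / 2) D /\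
    forall z, 0 < z < 1 -> f z = C z * KU z + D z * KV z.

(** The logarithm arises only from q = 0, where at least N factors 1 - z are available. Keeping (1 -
    z)^N outside [B] makes the size of [B] depend on w - 2 N alone, so that it stays bounded when N
    grows. *)
Definition elementary_class (N w : nat) (f : R -> R) : Prop :=
  exists P B, pz ((w + 1) / 2) P /\ pz ((w + 2 - 2 * N) / 2) B /\
    forall z, 0 < z < 1 -> f z = sqrt z * P z + (1 - z) ^ N * (B z * KL z).

Lemma KI_elliptic_nat k : elliptic_class k (KI 0 0 (Z.of_nat k)).
Proof.
enough (H : elliptic_class k (KI 0 0 (Z.of_nat k)) /\
  elliptic_class (S k) (KI 0 0 (Z.of_nat (S k)))) by apply H.
induction k as [|k [(C0 & D0 & HC0 & HD0 & E0) (C1 & D1 & HC1 & HD1 & E1)]].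
- split.
  + exists (fun _ => 1), (fun _ => 0); split; [apply pz_const|split; [apply pz_zero|]].
    intros; unfold KU; simpl; ring.
  + exists (fun _ => 0), (fun _ => 1); split; [apply pz_zero|split; [apply pz_const|]].
    intros; unfold KV; simpl; ring.
- split; [exists C1, D1; auto|].
  set (c := IZR (Z.of_nat (S k))).
  assert (Hc : 0 < c) by (apply IZR_lt; lia).
  exists (fun z => 2 * c / (c + 1 / 2) * C1 z + - (c - 1 / 2) / (c + 1 / 2) * ((1 - z) ^ 1 * C0 z)),
    (fun z => 2 * c / (c + 1 / 2) * D1 z + - (c - 1 / 2) / (c + 1 / 2) * ((1 - z) ^ 1 * D0 z)).
  assert (Ek : (S (S k) / 2 = k / 2 + 1)%nat).
  { replace (S (S k)) with (k + 1 * 2)%nat by lia; apply Nat.div_add; lia. }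
  assert (Ek' : ((S (S k) + 1) / 2 = (k + 1) / 2 + 1)%nat).
  { replace (S (S k) + 1)%nat with (k + 1 + 1 * 2)%nat by lia; apply Nat.div_add; lia. }
  split; [|split].
  + apply pz_lin.
    * apply (pz_le (S k / 2 + 1)); [|exact HC1].
      apply Nat.add_le_mono_r, Nat.Div0.div_le_mono; lia.
    * rewrite Ek; apply (pz_le (k / 2 + 1 + 1)); [lia|]; apply pz_1mX_pow, HC0.
  + apply pz_lin.
    * apply (pz_le ((S k + 1) / 2)); [|exact HD1]; apply Nat.Div0.div_le_mono; lia.
    * rewrite Ek'; apply pz_1mX_pow, HD0.
  + intros z Hz; pose proof (KI_recurrence (Z.of_nat (S k)) z Hz) as E.
    replace (Z.of_nat (S k) + 1)%Z with (Z.of_nat (S (S k))) in E by lia.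
    replace (Z.of_nat (S k) - 1)%Z with (Z.of_nat k) in E by lia.
    fold c in E; rewrite (E0 z Hz), (E1 z Hz) in E.
    apply (Rmult_eq_reg_l (c + 1 / 2)); [|lra].
    rewrite E; field; lra.
Qed.

(** For q = -k the symmetry trades k factors 1 - z for the sign of q: the weight 2 (r - k) + k is
    again 2 r + q, so one formula covers both signs. *)
Lemma KI_elliptic_leaf (r : nat) (q : Z) : (0 <= Z.of_nat r + q)%Z ->
  elliptic_class (Z.to_nat (2 * Z.of_nat r + q)) (fun z => (1 - z) ^ r * KI 0 0 q z).
Proof.
assert (A : forall r k, elliptic_class (2 * r + k) (fun z => (1 - z) ^ r * KI 0 0 (Z.of_nat k) z)).
{ clear r q; intros r k; destruct (KI_elliptic_nat k) as (C & D & HC & HD & E).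
  exists (fun z => (1 - z) ^ r * C z), (fun z => (1 - z) ^ r * D z); split; [|split].
  - apply (pz_le (k / 2 + 1 + r)); [|apply pz_1mX_pow, HC].
    replace (2 * r + k)%nat with (k + r * 2)%nat by lia; rewrite Nat.div_add; lia.
  - apply (pz_le ((k + 1) / 2 + r)); [|apply pz_1mX_pow, HD].
    replace (2 * r + k + 1)%nat with (k + 1 + r * 2)%nat by lia; rewrite Nat.div_add; lia.
  - intros z Hz; rewrite (E z Hz); ring. }
intro Hr; destruct (Z_le_gt_dec 0 q) as [Hq|Hq].
- destruct (Z_of_nat_complete q Hq) as [k ->].
  replace (Z.to_nat (2 * Z.of_nat r + Z.of_nat k)) with (2 * r + k)%nat by lia; apply A.
- destruct (Z_of_nat_complete (- q)) as [k Ek]; [lia|].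
  assert (q = - Z.of_nat k)%Z as -> by lia.
  replace (Z.to_nat (2 * Z.of_nat r + - Z.of_nat k)) with (2 * (r - k) + k)%nat by lia.
  destruct (A (r - k)%nat k) as (C & D & HC & HD & E).
  exists C, D; split; [exact HC | split; [exact HD|]].
  intros z Hz; rewrite <- (E z Hz), <- (KI_0_symmetry k z Hz).
  replace r with (r - k + k)%nat at 1 by lia; rewrite pow_add; ring.
Qed.

Lemma KI_1_integral q z : 0 < z < 1 -> q <> 0%Z ->
  KI 1 0 q z = (Rpower (1 + sqrt z) (IZR q) - Rpower (1 - sqrt z) (IZR q)) / IZR q.
Proof.
intros Hz Hq; apply (is_RInt_unique (V := R_CompleteNormedModule)).
assert (Hq' : IZR q <> 0) by (apply not_0_IZR, Hq).
set (F := fun t => / IZR q * Rpower (wz z t) (IZR q)).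
replace (_ / _) with (F PI - F 0)
  by (unfold F, wz; rewrite cos_PI, cos_0; replace (1 - sqrt z * -1) with (1 + sqrt z) by ring;
      replace (1 - sqrt z * 1) with (1 - sqrt z) by ring; field; exact Hq').
apply (is_RInt_derive (V := R_CompleteNormedModule) F).
- intros t _; pose proof (wz_pos z t Hz).
  evar_last.
  + apply (is_derive_scal (fun t => Rpower (wz z t) (IZR q))).
    apply is_derive_Rpower_comp; [assumption | apply wz_derive_t].
  + unfold KI_term; simpl; replace (IZR q - (1 + 1) / 2) with (IZR q - 1) by lra.
    field; exact Hq'.
- intros t _; apply continuous_KI_term, Hz.
Qed.

Lemma KI_1_log z : 0 < z < 1 -> KI 1 0 0 z = KL z.
Proof.
intros Hz; apply (is_RInt_unique (V := R_CompleteNormedModule)).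
set (F := fun t => ln (wz z t)).
replace (KL z) with (F PI - F 0)
  by (unfold KL, F, wz; rewrite cos_PI, cos_0; f_equal; f_equal; ring).
apply (is_RInt_derive (V := R_CompleteNormedModule) F).
- intros t _; pose proof (wz_pos z t Hz) as Hw.
  evar_last.
  + apply (is_derive_comp ln (wz z)); [apply is_derive_ln, Hw | apply wz_derive_t].
  + unfold KI_term; simpl; replace (0 - (1 + 1) / 2) with (- (1)) by lra.
    rewrite Rpower_Ropp, Rpower_1 by exact Hw.
    unfold scal; simpl; unfold mult; simpl; field; lra.
- intros t _; apply continuous_KI_term, Hz.
Qed.

(** 1 + s and 1 - s are the roots of X^2 - 2 X + (1 - z), whence a two-step recurrence with
    polynomial coefficients in z. *)
Lemma pow_diff_sqrt k : exists P, pz ((k + 1) / 2) P /\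
  forall z, 0 < z < 1 -> (1 + sqrt z) ^ k - (1 - sqrt z) ^ k = sqrt z * P z.
Proof.
enough (H : (exists P, pz ((k + 1) / 2) P /\
  forall z, 0 < z < 1 -> (1 + sqrt z) ^ k - (1 - sqrt z) ^ k = sqrt z * P z) /\
  (exists P, pz ((S k + 1) / 2) P /\
  forall z, 0 < z < 1 -> (1 + sqrt z) ^ S k - (1 - sqrt z) ^ S k = sqrt z * P z)) by apply H.
induction k as [|k [(P0 & H0 & E0) (P1 & H1 & E1)]].
- split.
  + exists (fun _ => 0); split; [apply pz_zero | intros; simpl; ring].
  + exists (fun _ => 2); split; [apply pz_const | intros; simpl; ring].
- split; [exists P1; auto|].
  exists (fun z => 2 * P1 z + -1 * ((1 - z) ^ 1 * P0 z)); split.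
  + apply pz_lin.
    * apply (pz_le ((S k + 1) / 2)); [|exact H1]; apply Nat.Div0.div_le_mono; lia.
    * replace (S (S k) + 1)%nat with (k + 1 + 1 * 2)%nat by lia; rewrite Nat.div_add by lia.
      apply pz_1mX_pow, H0.
  + intros z Hz; assert (Hs : sqrt z * sqrt z = z) by (apply sqrt_sqrt; lra).
    transitivity (2 * (sqrt z * P1 z) - (1 - z) * (sqrt z * P0 z)); [|ring].
    rewrite <- E0, <- E1 by exact Hz.
    replace (1 - z) with ((1 - sqrt z) * (1 + sqrt z)) by (rewrite <- Hs at 3; ring).
    simpl; ring.
Qed.

Lemma KI_elementary_leaf N (r : nat) (q : Z) : (Z.of_nat N <= Z.of_nat r + q)%Z ->
  elementary_class N (Z.to_nat (2 * Z.of_nat r + q)) (fun z => (1 - z) ^ r * KI 1 0 q z).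
Proof.
intro Hr; destruct (Z.eq_dec q 0) as [->|Hq].
- exists (fun _ => 0), (fun z => (1 - z) ^ (r - N) * 1); split; [apply pz_zero|split].
  + apply (pz_le (1 + (r - N))); [|apply pz_1mX_pow, pz_const].
    replace (Z.to_nat (2 * Z.of_nat r + 0) + 2 - 2 * N)%nat with ((1 + (r - N)) * 2)%nat by lia.
    rewrite Nat.div_mul; lia.
  + intros z Hz; rewrite KI_1_log by exact Hz.
    replace r with (N + (r - N))%nat at 1 by lia; rewrite pow_add; ring.
- assert (exists k, (0 < k)%nat /\ (q = Z.of_nat k \/ q = - Z.of_nat k)%Z) as (k & Hk & Eq).
  { exists (Z.to_nat (Z.abs q)); lia. }
  assert (Hk' : 0 < INR k) by (apply lt_0_INR; exact Hk).
  destruct (pow_diff_sqrt k) as (P & HP & EP).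
  (* For q = -k, bringing the two powers to the common denominator ((1 - s)(1 + s))^k = (1 - z)^k
     uses up k of the r factors. *)
  set (r' := (if Z_lt_dec q 0 then r - k else r)%nat).
  exists (fun z => (1 - z) ^ r' * (/ INR k * P z)), (fun _ => 0); split; [|split; [apply pz_zero|]].
  + apply (pz_le ((k + 1) / 2 + r')); [|apply pz_1mX_pow, pz_scal, HP].
    rewrite <- Nat.div_add by lia; apply Nat.Div0.div_le_mono.
    unfold r'; destruct Z_lt_dec; lia.
  + intros z Hz; rewrite KI_1_integral by assumption.
    pose proof (sqrt_Ioo z Hz).
    transitivity ((1 - z) ^ r' * (/ INR k * (sqrt z * P z))); [|ring].
    rewrite <- EP by exact Hz.
    unfold r'; destruct Z_lt_dec as [Hlt|Hlt].
    * assert (q = - Z.of_nat k)%Z as -> by lia.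
      rewrite opp_IZR, <- INR_IZR_INZ, !Rpower_Ropp, !Rpower_pow by lra.
      assert (Hs : sqrt z * sqrt z = z) by (apply sqrt_sqrt; lra).
      replace r with (r - k + k)%nat at 1 by lia; rewrite pow_add.
      assert (Ez : (1 - z) ^ k = (1 - sqrt z) ^ k * (1 + sqrt z) ^ k).
      { rewrite <- Rpow_mult_distr; f_equal; rewrite <- Hs at 1; ring. }
      rewrite Ez.
      assert ((1 - sqrt z) ^ k <> 0) by (apply pow_nonzero; lra).
      assert ((1 + sqrt z) ^ k <> 0) by (apply pow_nonzero; lra).
      field; repeat split; try assumption; lra.
    * assert (q = Z.of_nat k)%Z as -> by lia.
      rewrite <- INR_IZR_INZ, !Rpower_pow by lra; field; lra.
Qed.

(** Each of the three terms of [KI_lower] keeps the weight 2 r + q + 2 m from rising and r + q + m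
    from falling, when its factor 1 - z is counted in r. One induction on m therefore serves both
    families. *)
Lemma KI_descent (cls : nat -> (R -> R) -> Prop) (k : nat) (N : Z) :
  (forall w w' f, (w <= w')%nat -> cls w f -> cls w' f) ->
  (forall w f g h, (forall z, 0 < z < 1 -> h z = f z + g z) -> cls w f -> cls w g -> cls w h) ->
  (forall w c f, cls w f -> cls w (fun z => c * f z)) ->
  (forall r q, (N <= Z.of_nat r + q)%Z ->
    cls (Z.to_nat (2 * Z.of_nat r + q)) (fun z => (1 - z) ^ r * KI k 0 q z)) ->
  forall m r q, (N <= Z.of_nat r + q + Z.of_nat m)%Z ->
    cls (Z.to_nat (2 * Z.of_nat r + q + 2 * Z.of_nat m)) (fun z => (1 - z) ^ r * KI k m q z).
Proof.
intros Mono Plus Scal Leaf; induction m as [|m IH]; intros r q H.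
- rewrite !Z.add_0_r in *; apply Leaf, H.
- set (w := Z.to_nat (2 * Z.of_nat r + q + 2 * Z.of_nat (S m))).
  assert (H1 : cls w (fun z => (1 - z) ^ S r * KI k m q z))
    by (eapply Mono; [|apply IH]; lia).
  assert (H2 : cls w (fun z => (1 - z) ^ r * KI k m (q + 1) z))
    by (eapply Mono; [|apply IH]; lia).
  assert (H3 : cls w (fun z => (1 - z) ^ r * KI k m (q + 2) z))
    by (eapply Mono; [|apply IH]; lia).
  apply (Scal w (-1)) in H1; apply (Scal w 2) in H2; apply (Scal w (-1)) in H3.
  refine (Plus w _ _ _ _ H1 (Plus w _ _ _ _ H2 H3)); [|intros; reflexivity].
  intros z Hz; rewrite KI_lower by exact Hz; simpl; ring.
Qed.

Lemma elliptic_class_le w w' f : (w <= w')%nat -> elliptic_class w f -> elliptic_class w' f.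
Proof.
intros H (C & D & HC & HD & E); exists C, D; split; [|split; [|exact E]].
- apply (pz_le (w / 2 + 1)); [|exact HC]; apply Nat.add_le_mono_r, Nat.Div0.div_le_mono, H.
- apply (pz_le ((w + 1) / 2)); [|exact HD]; apply Nat.Div0.div_le_mono; lia.
Qed.

Lemma elementary_class_le N w w' f :
  (w <= w')%nat -> elementary_class N w f -> elementary_class N w' f.
Proof.
intros H (C & D & HC & HD & E); exists C, D; split; [|split; [|exact E]].
- apply (pz_le ((w + 1) / 2)); [|exact HC]; apply Nat.Div0.div_le_mono; lia.
- apply (pz_le ((w + 2 - 2 * N) / 2)); [|exact HD]; apply Nat.Div0.div_le_mono; lia.
Qed.

Lemma elliptic_KI m r q : (0 <= Z.of_nat r + q + Z.of_nat m)%Z ->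
  elliptic_class (Z.to_nat (2 * Z.of_nat r + q + 2 * Z.of_nat m))
    (fun z => (1 - z) ^ r * KI 0 m q z).
Proof.
apply KI_descent.
- apply elliptic_class_le.
- intros w f g h E (C & D & HC & HD & E1) (C' & D' & HC' & HD' & E2).
  exists (fun z => C z + C' z), (fun z => D z + D' z); split; [apply pz_plus; assumption|].
  split; [apply pz_plus; assumption|].
  intros z Hz; rewrite E, E1, E2 by exact Hz; ring.
- intros w c f (C & D & HC & HD & E1).
  exists (fun z => c * C z), (fun z => c * D z); split; [apply pz_scal, HC|].
  split; [apply pz_scal, HD|].
  intros z Hz; rewrite E1 by exact Hz; ring.
- intros; apply KI_elliptic_leaf; assumption.
Qed.

Lemma elementary_KI N m r q : (Z.of_nat N <= Z.of_nat r + q + Z.of_nat m)%Z ->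
  elementary_class N (Z.to_nat (2 * Z.of_nat r + q + 2 * Z.of_nat m))
    (fun z => (1 - z) ^ r * KI 1 m q z).
Proof.
apply (KI_descent (elementary_class N)).
- apply elementary_class_le.
- intros w f g h E (C & D & HC & HD & E1) (C' & D' & HC' & HD' & E2).
  exists (fun z => C z + C' z), (fun z => D z + D' z); split; [apply pz_plus; assumption|].
  split; [apply pz_plus; assumption|].
  intros z Hz; rewrite E, E1, E2 by exact Hz; ring.
- intros w c f (C & D & HC & HD & E1).
  exists (fun z => c * C z), (fun z => c * D z); split; [apply pz_scal, HC|].
  split; [apply pz_scal, HD|].
  intros z Hz; rewrite E1 by exact Hz; ring.
- intros; apply KI_elementary_leaf; assumption.
Qed.

(** For degree n the moments have i + j at most n + 1, so N = n - 3 clears the powers (1 -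
    z)^(4-i-j). *)
Definition melnikov_class (N : nat) (f : R -> R) : Prop :=
  exists C D P B, pz (N + 3) C /\ pz (N + 2) D /\ pz (N + 2) P /\ pz 2 B /\
    forall z, 0 < z < 1 ->
      (1 - z) ^ N * f z = C z * KU z + D z * KV z + sqrt z * P z + (1 - z) ^ N * (B z * KL z).

Lemma melnikov_class_lin N a b f g : melnikov_class N f -> melnikov_class N g ->
  melnikov_class N (fun z => a * f z + b * g z).
Proof.
intros (C & D & P & B & HC & HD & HP & HB & E) (C' & D' & P' & B' & HC' & HD' & HP' & HB' & E').
exists (fun z => a * C z + b * C' z), (fun z => a * D z + b * D' z),
  (fun z => a * P z + b * P' z), (fun z => a * B z + b * B' z).
repeat (split; [apply pz_lin; assumption|]).
intros z Hz; transitivity (a * ((1 - z) ^ N * f z) + b * ((1 - z) ^ N * g z)); [ring|].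
rewrite E, E' by exact Hz; ring.
Qed.

Lemma melnikov_class_sum N (f : nat -> R -> R) n : (forall i, (i <= n)%nat -> melnikov_class N (f i)) ->
  melnikov_class N (fun z => sum_f_R0 (fun i => f i z) n).
Proof.
intro H; induction n as [|n IH]; simpl; [apply H; lia|].
assert (H1 : melnikov_class N (fun z => sum_f_R0 (fun i => f i z) n)) by (apply IH; intros; apply H; lia).
destruct (melnikov_class_lin N 1 1 _ _ H1 (H (S n) (le_n _))) as (C & D & P & B & HC & HD & HP & HB & E).
exists C, D, P, B; repeat (split; [assumption|]).
intros z Hz; rewrite <- E by exact Hz; ring.
Qed.

(** With j = 2 m or j = 2 m + 1 the weight is 2 N + 4 - i - m. The condition i + j >= 1 is what
    keeps [B] affine: for i = j = 0 the bound would allow degree 2. *)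
Lemma arc_moment_class N i j : (1 <= i + j <= N + 4)%nat ->
  melnikov_class N (fun z => arc_moment (z - 1) i j).
Proof.
intros Hij; set (r := (N + 4 - (i + j))%nat).
destruct (Nat.Even_or_Odd j) as [[m Em]|[m Em]].
- pose proof (elementary_KI N m r (Z.of_nat (i + m + 1) - 5)) as H.
  destruct H as (P & B & HP & HB & E); [unfold r; lia|].
  exists (fun _ => 0), (fun _ => 0), (fun z => sqrt 2 ^ j * P z), (fun z => sqrt 2 ^ j * B z).
  split; [apply pz_zero|split; [apply pz_zero|split; [|split]]].
  + apply pz_scal; eapply pz_le; [|exact HP].
    apply Nat.Div0.div_le_upper_bound; unfold r; lia.
  + apply pz_scal; eapply pz_le; [|exact HB].
    apply Nat.lt_succ_r, Nat.Div0.div_lt_upper_bound; unfold r; lia.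
  + intros z Hz; rewrite (arc_moment_KI N i j 1 m r z Hz) by (unfold r; lia).
    rewrite (E z Hz); ring.
- pose proof (elliptic_KI (S m) r (Z.of_nat (i + S m + 0) - 5)) as H.
  destruct H as (C & D & HC & HD & E); [unfold r; lia|].
  exists (fun z => sqrt 2 ^ j * C z), (fun z => sqrt 2 ^ j * D z), (fun _ => 0), (fun _ => 0).
  split; [|split; [|split; [apply pz_zero|split; [apply pz_zero|]]]].
  + apply pz_scal; eapply pz_le; [|exact HC].
    replace (N + 3)%nat with (N + 2 + 1)%nat by lia; apply (proj1 (Nat.add_le_mono_r _ _ 1)).
    apply Nat.Div0.div_le_upper_bound; unfold r; lia.
  + apply pz_scal; eapply pz_le; [|exact HD].
    apply Nat.lt_succ_r, Nat.Div0.div_lt_upper_bound; unfold r; lia.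
  + intros z Hz; rewrite (arc_moment_KI N i j 0 (S m) r z Hz) by (unfold r; lia).
    rewrite (E z Hz); ring.
Qed.

Lemma melnikov_in_class N n ap bp am bm M : (n <= N + 3)%nat ->
  (forall h, -1 < h < 0 -> is_melnikov n ap bp am bm h (M h)) ->
  melnikov_class N (fun z => M (z - 1)).
Proof.
intros Hn HM; destruct (melnikov_moments n ap bp am bm) as (a & b & E).
assert (H : melnikov_class N (fun z => sum_f_R0 (fun i => sum_f_R0 (fun j =>
  b i j * arc_moment (z - 1) (S i) j + a i j * arc_moment (z - 1) i (S j)) (n - i)) n)).
{ apply (melnikov_class_sum N (fun i z => sum_f_R0 (fun j =>
    b i j * arc_moment (z - 1) (S i) j + a i j * arc_moment (z - 1) i (S j)) (n - i))); intros i Hi.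
  apply (melnikov_class_sum N (fun j z =>
    b i j * arc_moment (z - 1) (S i) j + a i j * arc_moment (z - 1) i (S j))); intros j Hj.
  apply melnikov_class_lin; apply arc_moment_class; lia. }
destruct H as (C & D & P & B & HC & HD & HP & HB & E').
exists C, D, P, B; repeat (split; [assumption|]).
intros z Hz; rewrite <- E' by exact Hz; f_equal; apply E; [lra | apply HM; lra].
Qed.

(** * Counting zeros *)

Notation smooth01 := (smooth 0 1).
Notation Zb01 := (Zb 0 1).

Lemma smooth_pz a b n f : pz n f -> smooth a b f.
Proof.
intros Hf m; revert n f Hf; induction m as [|m IH]; intros n f Hf; [exact I|].
destruct (pz_deriv n f Hf) as (g & Hg & D).
apply (Cn_intro a b m f g); [intros; apply D | apply (IH _ _ Hg)].
Qed.

Lemma is_derive_Rpower c x : 0 < x ->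
  is_derive (fun z => Rpower z c) x (c * Rpower x (c - 1)).
Proof. intros Hx; apply is_derive_Reals, derivable_pt_lim_power, Hx. Qed.

Lemma is_derive_Rpower_1m c x : 0 < x < 1 ->
  is_derive (fun z => Rpower (1 - z) c) x (- c * Rpower (1 - x) (c - 1)).
Proof.
intros Hx; evar_last.
- apply (is_derive_Rpower_comp (fun z => 1 - z) c x (-1)); [lra|].
  auto_derive; [exact I | ring].
- ring.
Qed.

Lemma smooth_Rpower c : smooth01 (fun z => Rpower z c).
Proof.
intro n; revert c; induction n as [|n IH]; intro c; [exact I|].
apply (Cn_intro 0 1 n _ (fun z => c * Rpower z (c - 1))).
- intros x Hx; apply is_derive_Rpower; lra.
- apply Cn_mult; [apply Cn_const | apply IH].
Qed.

Lemma smooth_Rpower_1m c : smooth01 (fun z => Rpower (1 - z) c).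
Proof.
intro n; revert c; induction n as [|n IH]; intro c; [exact I|].
apply (Cn_intro 0 1 n _ (fun z => - c * Rpower (1 - z) (c - 1))).
- intros x Hx; apply is_derive_Rpower_1m; lra.
- apply Cn_mult; [apply Cn_const | apply IH].
Qed.

Lemma Rpower_m1 x : 0 < x -> Rpower x (-1) = / x.
Proof. intro Hx; replace (-1) with (- (1)) by ring; rewrite Rpower_Ropp, Rpower_1; auto. Qed.

(** Each derivative involves both functions, hence the joint induction on the order. *)
Lemma smooth_KU_KV : smooth01 KU /\ smooth01 KV.
Proof.
assert (H : forall n, Cn 0 1 n KU /\ Cn 0 1 n KV); [|split; intro n; apply H].
induction n as [|n [IHU IHV]]; [split; exact I|].
assert (C1 : Cn 0 1 n (fun z => 1 - z)) by apply (smooth_pz _ _ _ _ pz_1mX).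
split.
- apply (Cn_intro 0 1 n _ (fun z => / 4 * (Rpower z (-1) * (Rpower (1 - z) (-1) *
     (KV z + -1 * ((1 - z) * KU z)))))).
  + intros x Hx; evar_last; [apply KU_derive, Hx|].
    rewrite !Rpower_m1 by lra; field; lra.
  + repeat apply Cn_mult; try apply Cn_const; try apply smooth_Rpower; try apply smooth_Rpower_1m.
    apply Cn_plus; [exact IHV|].
    repeat apply Cn_mult; [apply Cn_const | exact C1 | exact IHU].
- apply (Cn_intro 0 1 n _ (fun z => / 4 * (Rpower z (-1) * (KV z + -1 * KU z)))).
  + intros x Hx; evar_last; [apply KV_derive, Hx|].
    rewrite !Rpower_m1 by lra; field; lra.
  + repeat apply Cn_mult; try apply Cn_const; try apply smooth_Rpower.
    apply Cn_plus; [exact IHV|].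
    apply Cn_mult; [apply Cn_const | exact IHU].
Qed.

Lemma KL_derive z : 0 < z < 1 ->
  is_derive KL z (Rpower z (- 1 / 2) * Rpower (1 - z) (- (1))).
Proof.
intro Hz; pose proof (sqrt_Ioo z Hz).
replace (- 1 / 2) with (- / 2) by lra.
rewrite !Rpower_Ropp, Rpower_1, Rpower_sqrt by lra.
assert (Hs : sqrt z * sqrt z = z) by (apply sqrt_sqrt; lra).
unfold KL; auto_derive; [repeat split; lra|].
replace (1 - z) with ((1 - sqrt z) * (1 + sqrt z)) by (rewrite <- Hs at 3; ring).
field; lra.
Qed.

Lemma smooth_KL : smooth01 KL.
Proof.
apply (smooth_intro 0 1 _ _ KL_derive).
apply smooth_mult; [apply smooth_Rpower | apply smooth_Rpower_1m].
Qed.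

(** A shape stable under derivation: the denominators of U' and V' divide 4 z (1 - z), so both
    exponents drop by 1 and [d] grows by 1. *)
Definition elliptic_form (l m : R) (d : nat) (f : R -> R) : Prop :=
  exists C D, pz (d + 1) C /\ pz d D /\ forall z, 0 < z < 1 ->
    f z = Rpower z l * Rpower (1 - z) m * (C z * KU z + D z * KV z).

Definition algebraic_form (l m : R) (d : nat) (f : R -> R) : Prop :=
  exists P, pz d P /\ forall z, 0 < z < 1 ->
    f z = Rpower z l * Rpower (1 - z) m * P z.

Lemma smooth_elliptic_form l m d f : elliptic_form l m d f -> smooth01 f.
Proof.
intros (C & D & HC & HD & E); destruct smooth_KU_KV.
apply (smooth_ext 0 1 (fun z => Rpower z l * Rpower (1 - z) m * (C z * KU z + D z * KV z))).
- intros; symmetry; apply E; assumption.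
- repeat first [apply smooth_mult | apply smooth_plus]; try assumption;
    try apply smooth_Rpower; try apply smooth_Rpower_1m; eapply smooth_pz; eassumption.
Qed.

Lemma smooth_algebraic_form l m d f : algebraic_form l m d f -> smooth01 f.
Proof.
intros (P & HP & E).
apply (smooth_ext 0 1 (fun z => Rpower z l * Rpower (1 - z) m * P z)).
- intros; symmetry; apply E; assumption.
- repeat apply smooth_mult; try apply smooth_Rpower; try apply smooth_Rpower_1m.
  apply (smooth_pz 0 1 d P HP).
Qed.

Lemma is_derive_mult_R (f g : R -> R) x lf lg : is_derive f x lf -> is_derive g x lg ->
  is_derive (fun x => f x * g x) x (lf * g x + f x * lg).
Proof. intros Hf Hg; apply (is_derive_mult f g x lf lg Hf Hg); intros; apply Rmult_comm. Qed.

Lemma is_derive_plus_R (f g : R -> R) x lf lg : is_derive f x lf -> is_derive g x lg ->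
  is_derive (fun x => f x + g x) x (lf + lg).
Proof. intros Hf Hg; apply (is_derive_plus f g x lf lg Hf Hg). Qed.

Lemma Rpower_pred x c : 0 < x -> Rpower x c = Rpower x (c - 1) * x.
Proof.
intro Hx; rewrite <- (Rpower_1 x Hx) at 3; rewrite <- Rpower_plus; f_equal; ring.
Qed.

Lemma is_derive_weight l m z : 0 < z < 1 ->
  is_derive (fun z => Rpower z l * Rpower (1 - z) m) z
    (Rpower z (l - 1) * Rpower (1 - z) (m - 1) * (l * (1 - z) - m * z)).
Proof.
intro Hz; evar_last.
- apply is_derive_mult_R; [apply is_derive_Rpower; lra | apply is_derive_Rpower_1m, Hz].
- cbv beta; rewrite (Rpower_pred z l), (Rpower_pred (1 - z) m) by lra; ring.
Qed.

Lemma pz_mult_le m n k f g : pz m f -> pz n g -> (Nat.pred (m + n) <= k)%nat ->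
  pz k (fun x => f x * g x).
Proof. intros Hf Hg H; apply (pz_le _ k _ H), pz_mult; assumption. Qed.

Lemma pz_X1mX : pz 3 (fun z => z * (1 - z)).
Proof. apply (pz_mult 2 2 (fun z => z)); [apply pz_id | apply pz_1mX]. Qed.

Lemma pz_affine a b : pz 2 (fun z => a * (1 - z) - b * z).
Proof.
apply (pz_ext 2 (fun z => a * (1 - z) + - b * z)); [intro; ring|].
apply (pz_lin 2 a (- b) (fun z => 1 - z) (fun z => z)); [apply pz_1mX | apply pz_id].
Qed.

Lemma algebraic_form_derive l m d f : algebraic_form l m (S d) f ->
  algebraic_form (l - 1) (m - 1) (S (S d)) (Derive f).
Proof.
intros (P & HP & E); destruct (pz_deriv _ _ HP) as (P' & HP' & DP).
exists (fun z => (l * (1 - z) - m * z) * P z + z * (1 - z) * P' z); split.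
- apply pz_plus.
  + apply (pz_mult_le 2 (S d) _ (fun z => l * (1 - z) - m * z));
      [apply pz_affine | exact HP | simpl; lia].
  + apply (pz_mult_le 3 d _ (fun z => z * (1 - z))); [apply pz_X1mX | exact HP' | simpl; lia].
- intros z Hz; rewrite (Derive_ext_Ioo 0 1 _ _ E z Hz); apply is_derive_unique; evar_last.
  + apply (is_derive_mult_R (fun z => Rpower z l * Rpower (1 - z) m) P);
      [apply is_derive_weight, Hz | apply DP].
  + cbv beta; rewrite (Rpower_pred z l), (Rpower_pred (1 - z) m) by lra; ring.
Qed.

Lemma elliptic_form_derive l m d f : elliptic_form l m (S d) f ->
  elliptic_form (l - 1) (m - 1) (S (S d)) (Derive f).
Proof.
intros (C & D & HC & HD & E); destruct (pz_deriv _ _ HC) as (C' & HC' & DC).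
destruct (pz_deriv _ _ HD) as (D' & HD' & DD); simpl in HC', HD'.
exists (fun z => ((l - / 4) * (1 - z) - m * z) * C z + z * (1 - z) * C' z + (- / 4 * (1 - z) - 0 * z) * D z),
  (fun z => ((l + / 4) * (1 - z) - m * z) * D z + z * (1 - z) * D' z + / 4 * C z).
split; [|split].
- apply pz_plus; [apply pz_plus|].
  + apply (pz_mult_le 2 (S d + 1) _ (fun z => (l - / 4) * (1 - z) - m * z));
      [apply pz_affine | exact HC | simpl; lia].
  + apply (pz_mult_le 3 (d + 1) _ (fun z => z * (1 - z)));
      [apply pz_X1mX | exact HC' | simpl; lia].
  + apply (pz_mult_le 2 (S d) _ (fun z => - / 4 * (1 - z) - 0 * z));
      [apply pz_affine | exact HD | simpl; lia].
- apply pz_plus; [apply pz_plus|].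
  + apply (pz_mult_le 2 (S d) _ (fun z => (l + / 4) * (1 - z) - m * z));
      [apply pz_affine | exact HD | simpl; lia].
  + apply (pz_mult_le 3 d _ (fun z => z * (1 - z)));
      [apply pz_X1mX | exact HD' | simpl; lia].
  + apply pz_scal, (pz_le (S d + 1)); [lia | exact HC].
- intros z Hz; rewrite (Derive_ext_Ioo 0 1 _ _ E z Hz); apply is_derive_unique; evar_last.
  + apply (is_derive_mult_R (fun z => Rpower z l * Rpower (1 - z) m) (fun z => C z * KU z + D z * KV z));
      [apply is_derive_weight, Hz |].
    apply is_derive_plus_R; apply is_derive_mult_R;
      [apply DC | apply KU_derive, Hz | apply DD | apply KV_derive, Hz].
  + cbv beta; rewrite (Rpower_pred z l), (Rpower_pred (1 - z) m) by lra; field; lra.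
Qed.

Lemma Zb_pz a b n f : pz n f -> Zb a b f (Nat.pred n).
Proof.
destruct n as [|n]; [intro H; left; intros; apply pz_0, H|].
simpl; revert f; induction n as [|n IH]; intros f Hf.
- destruct (pz_1 f Hf) as [c Hc]; destruct (Req_dec c 0) as [->|H].
  + left; intros; apply Hc.
  + right; apply nz_nonzero; intros; rewrite Hc; exact H.
- apply Zb_rolle; [apply (smooth_pz a b _ _ Hf)|].
  destruct (pz_deriv _ _ Hf) as (g & Hg & D).
  apply (Zb_ext a b g); [intros; symmetry; apply is_derive_unique, D | apply IH, Hg].
Qed.

(** Eliminating V between y = C U + D V and y' gives Dl y' = Sg y + U Rh with U positive. [Dl] has
    at most d + 1 zeros and [Rh] at most 2 d; Khovanskii-Rolle adds one. *)
Lemma Zb_elliptic d C D : pz (d + 1) C -> pz d D ->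
  Zb01 (fun z => C z * KU z + D z * KV z) (3 * d + 2).
Proof.
intros HC HD; destruct smooth_KU_KV as [SU SV].
assert (SC : smooth01 C) by apply (smooth_pz _ _ _ _ HC).
assert (SD : smooth01 D) by apply (smooth_pz _ _ _ _ HD).
(* If D = 0, the coefficient of y' vanishes and the equation is useless, but y = C U has the zeros
   of C. *)
destruct (classic (forall x, D x = 0)) as [D0|D0].
{ destruct (Zb_pz 0 1 _ _ HC) as [Z|N].
  - left; intros x Hx; rewrite D0, Z by exact Hx; ring.
  - right; apply (nz_le 0 1 _ d); [lia|].
    rewrite Nat.add_1_r in N; apply (nz_imp 0 1 _ C); [|exact N].
    intros t m Ht V; apply (van_mult_cancel 0 1 m C KU); auto.
    + pose proof (KU_pos t Ht); lra.
    + apply (van_ext 0 1 m (fun z => C z * KU z + D z * KV z)); auto.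
      intros; rewrite D0; ring. }
assert (Hd : (1 <= d)%nat) by (destruct d; [elim D0; apply pz_0, HD | lia]).
destruct (pz_deriv _ _ HC) as (C' & HC' & DC).
destruct (pz_deriv _ _ HD) as (D' & HD' & DD).
set (Dl := fun z => 4 * z * (1 - z) * D z).
set (Rh := fun x => 4 * x * (1 - x) * (D x * C' x - D' x * C x)
     - (1 - x) * (D x * D x + 2 * D x * C x) - C x * C x).
set (Sg := fun z => 4 * z * (1 - z) * D' z + C z + (1 - z) * D z).
assert (P4 : pz 3 (fun z => 4 * z * (1 - z))).
{ apply (pz_ext 3 (fun z => 4 * (z * (1 - z)))); [intro; ring | apply pz_scal, pz_X1mX]. }
assert (PDl : pz (d + 2) Dl).
{ apply (pz_mult_le 3 d _ (fun z => 4 * z * (1 - z))); [exact P4 | exact HD | lia]. }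
assert (PRh : pz (2 * d + 1) Rh).
{ apply (pz_ext _ (fun x => 4 * x * (1 - x) * (1 * (D x * C' x) + -1 * (D' x * C x)) +
     -1 * ((1 - x) * (1 * (D x * D x) + 2 * (D x * C x))) + -1 * (C x * C x)));
    [intro; unfold Rh; ring|].
  apply pz_plus; [apply pz_plus|].
  - apply (pz_mult_le 3 (2 * d - 1) _ (fun z => 4 * z * (1 - z))); [exact P4 | | lia].
    apply pz_lin; [apply (pz_mult_le d d _ D); [exact HD | | lia] |
      apply (pz_mult_le (Nat.pred d) (d + 1) _ D'); [exact HD' | exact HC | lia]].
    apply (pz_le (Nat.pred (d + 1)) d); [lia | exact HC'].
  - apply pz_scal, (pz_mult_le 2 (2 * d) _ (fun z => 1 - z)); [apply pz_1mX | | lia].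
    apply pz_lin; [apply (pz_mult_le d d _ D); [exact HD | exact HD | lia] |
      apply (pz_mult_le d (d + 1) _ D); [exact HD | exact HC | lia]].
  - apply pz_scal, (pz_mult_le (d + 1) (d + 1) _ C); [exact HC | exact HC | lia]. }
assert (PSg : pz (d + 3) Sg).
{ apply pz_plus; [apply pz_plus|].
  - apply (pz_mult_le 3 (Nat.pred d) _ (fun z => 4 * z * (1 - z))); [exact P4 | exact HD' | lia].
  - apply (pz_le (d + 1)); [lia | exact HC].
  - apply (pz_mult_le 2 d _ (fun z => 1 - z)); [apply pz_1mX | exact HD | lia]. }
assert (NDl : nz 0 1 Dl (d + 1)).
{ destruct (Zb_pz 0 1 _ _ PDl) as [Z|N].
  - exfalso; apply D0, (pz_eq0_Ioo d D HD); intros x Hx; specialize (Z x Hx).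
    unfold Dl in Z; apply Rmult_integral in Z; destruct Z as [Z|]; [|assumption]; nra.
  - apply (nz_le 0 1 _ _ _ (ltac:(lia) : (Nat.pred (d + 2) <= d + 1)%nat) N). }
assert (NRh : nz 0 1 Rh (2 * d)).
{ destruct (Zb_pz 0 1 _ _ PRh) as [Z|N].
  - exfalso; apply D0, (riccati_fun_irreducible _ _ C D C' D' HC HD DC DD).
    apply (pz_eq0_Ioo _ Rh PRh), Z.
  - apply (nz_le 0 1 _ _ _ (ltac:(lia) : (Nat.pred (2 * d + 1) <= 2 * d)%nat) N). }
right; replace (3 * d + 2)%nat with (d + 1 + 2 * d + 1)%nat by lia.
apply (linear_ode_zeros 0 1 _ Dl Sg KU Rh); auto.
- apply smooth_plus; apply smooth_mult; assumption.
- apply (smooth_pz _ _ _ _ PDl).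
- apply (smooth_pz _ _ _ _ PSg).
- apply (smooth_pz _ _ _ _ PRh).
- intros x Hx; pose proof (KU_pos x Hx); lra.
- intros x Hx.
  assert (E : Derive (fun z => C z * KU z + D z * KV z) x =
    C' x * KU x + C x * ((KV x - (1 - x) * KU x) / (4 * x * (1 - x))) +
    (D' x * KV x + D x * ((KV x - KU x) / (4 * x)))).
  { apply is_derive_unique, is_derive_plus_R; apply is_derive_mult_R;
      [apply DC | apply KU_derive, Hx | apply DD | apply KV_derive, Hx]. }
  rewrite E; unfold Dl, Sg, Rh; field; lra.
Qed.

Lemma Zb_elliptic_form l m d f : elliptic_form l m d f -> Zb01 f (3 * d + 2).
Proof.
intros Hf; pose proof (smooth_elliptic_form _ _ _ _ Hf) as Sf.
destruct Hf as (C & D & HC & HD & E).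
apply (Zb_mult 0 1 f (fun z => Rpower z (- l) * Rpower (1 - z) (- m))); auto.
- apply smooth_mult; [apply smooth_Rpower | apply smooth_Rpower_1m].
- intros x _; unfold Rpower; apply Rgt_not_eq, Rmult_lt_0_compat; apply exp_pos.
- apply (Zb_ext 0 1 (fun z => C z * KU z + D z * KV z)); [|apply Zb_elliptic; assumption].
  intros x Hx; rewrite E by exact Hx.
  transitivity (Rpower x (- l + l) * Rpower (1 - x) (- m + m) * (C x * KU x + D x * KV x)).
  + rewrite !Rplus_opp_l, !Rpower_O by lra; ring.
  + rewrite !Rpower_plus; ring.
Qed.

(** k derivatives annihilate Q. Each costs one zero and enlarges the elliptic part by one, which
    explains the term S d + k. *)
Lemma Zb_elliptic_plus_pz k : forall l m d f e Q,
  (forall z, 0 < z < 1 -> f z = e z + Q z) ->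
  elliptic_form l m (S d) e -> pz k Q -> Zb01 f (k + (3 * (S d + k) + 2)).
Proof.
induction k as [|k IH]; intros l m d f e Q E He HQ.
- apply (Zb_ext 0 1 e).
  + intros x Hx; rewrite E, (pz_0 Q HQ) by exact Hx; ring.
  + apply (Zb_le 0 1 _ (3 * S d + 2)); [lia | apply (Zb_elliptic_form l m), He].
- pose proof (smooth_elliptic_form _ _ _ _ He) as Se.
  destruct (pz_deriv _ _ HQ) as (Q' & HQ' & DQ).
  replace (S k + (3 * (S d + S k) + 2))%nat with (S (k + (3 * (S (S d) + k) + 2))) by lia.
  apply Zb_rolle.
  + apply (smooth_ext 0 1 (fun z => e z + Q z)); [intros; symmetry; auto|].
    apply smooth_plus; [exact Se | apply (smooth_pz _ _ _ _ HQ)].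
  + apply (IH (l - 1) (m - 1) (S d) _ (Derive e) Q').
    * intros z Hz; rewrite (Derive_ext_Ioo 0 1 _ _ E z Hz); apply is_derive_unique.
      apply is_derive_plus_R; [apply (smooth_is_derive 0 1); assumption | apply DQ].
    * apply elliptic_form_derive, He.
    * exact HQ'.
Qed.

Lemma Rpower_mult_neq_0 l m x : Rpower x l * Rpower (1 - x) m <> 0.
Proof. unfold Rpower; apply Rgt_not_eq, Rmult_lt_0_compat; apply exp_pos. Qed.

Lemma melnikov_class_zeros N f : melnikov_class N f -> smooth01 f /\ Zb01 f (7 * N + 32).
Proof.
intros (C & D & P & B & HC & HD & HP & HB & E).
replace (N + 3)%nat with (S (S N) + 1)%nat in HC by lia.
replace (N + 2)%nat with (S (S N)) in HD, HP by lia.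
set (n := INR N).
set (e0 := fun z => Rpower z 0 * Rpower (1 - z) (- n) * (C z * KU z + D z * KV z)).
set (p0 := fun z => Rpower z (/ 2) * Rpower (1 - z) (- n) * P z).
set (w0 := fun z => Rpower z (- 1 / 2) * Rpower (1 - z) (- (1))).
set (b0 := fun z => w0 z * B z).
assert (He0 : elliptic_form 0 (- n) (S (S N)) e0) by (exists C, D; auto).
assert (Hp0 : algebraic_form (/ 2) (- n) (S (S N)) p0) by (exists P; auto).
assert (Hb0 : algebraic_form (- 1 / 2) (- (1)) 2 b0) by (exists B; auto).
assert (Sw0 : smooth01 w0) by (apply smooth_mult; [apply smooth_Rpower | apply smooth_Rpower_1m]).
assert (SB : smooth01 B) by apply (smooth_pz _ _ _ _ HB).
assert (Ef : forall z, 0 < z < 1 -> e0 z + p0 z + B z * KL z = f z).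
{ intros z Hz.
  assert (H1 : 0 < (1 - z) ^ N) by (apply pow_lt; lra).
  apply (Rmult_eq_reg_l ((1 - z) ^ N)); [|lra].
  rewrite E by exact Hz; unfold e0, p0, n.
  rewrite Rpower_O, Rpower_Ropp, Rpower_pow, Rpower_sqrt by lra; field; lra. }
pose proof (elliptic_form_derive _ _ _ _ He0) as He1.
pose proof (elliptic_form_derive _ _ _ _ He1) as He2.
pose proof (algebraic_form_derive _ _ _ _ Hp0) as Hp1.
pose proof (algebraic_form_derive _ _ _ _ Hp1) as Hp2.
pose proof (algebraic_form_derive _ _ _ _ Hb0) as Hb1.
pose proof (smooth_elliptic_form _ _ _ _ He0) as Se0.
pose proof (smooth_elliptic_form _ _ _ _ He1) as Se1.
pose proof (smooth_algebraic_form _ _ _ _ Hp0) as Sp0.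
pose proof (smooth_algebraic_form _ _ _ _ Hp1) as Sp1.
pose proof (smooth_algebraic_form _ _ _ _ Hb0) as Sb0.
assert (Sf : smooth01 f).
{ apply (smooth_ext 0 1 _ _ Ef), smooth_plus; [apply smooth_plus; assumption|].
  apply smooth_mult; [exact SB | apply smooth_KL]. }
(* As B' = c is constant and [b0] is B KL', the second derivative of B KL is c KL' + b0', free of
   the logarithm. *)
destruct (pz_deriv _ _ HB) as (B' & HB' & DB); destruct (pz_1 B' HB') as [c Hc].
assert (E1 : forall z, 0 < z < 1 -> Derive e0 z + Derive p0 z + (c * KL z + b0 z) = Derive f z).
{ intros z Hz; rewrite <- (Derive_ext_Ioo 0 1 _ _ Ef z Hz).
  symmetry; apply is_derive_unique; evar_last.
  - apply is_derive_plus_R; [apply is_derive_plus_R; apply (smooth_is_derive 0 1); assumption|].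
    apply is_derive_mult_R; [apply DB | apply KL_derive, Hz].
  - cbv beta; rewrite Hc; unfold b0, w0; ring. }
assert (E2 : forall z, 0 < z < 1 -> Derive (Derive e0) z + Derive (Derive p0) z +
    (c * w0 z + Derive b0 z) = Derive (Derive f) z).
{ intros z Hz; rewrite <- (Derive_ext_Ioo 0 1 _ _ E1 z Hz).
  symmetry; apply is_derive_unique.
  apply is_derive_plus_R; [apply is_derive_plus_R; apply (smooth_is_derive 0 1); assumption|].
  apply is_derive_plus_R; [|apply (smooth_is_derive 0 1); assumption].
  apply (is_derive_scal KL), KL_derive, Hz. }
split; [exact Sf|].
(* Two Rolle steps, then k = N + 4 and an elliptic part with [d] = N + 4: 2 + (N + 4) + 3 (2 N + 8)
   + 2 = 7 N + 32. *)
apply (Zb_le 0 1 f (S (S (S (S (S (S N))) + (3 * (S (S (S (S N))) + S (S (S (S N)))) + 2))))); [lia|].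
apply Zb_rolle; [exact Sf|]; apply Zb_rolle; [apply smooth_Derive, Sf|].
(* The multiplier cancels the weight z^(-3/2) (1 - z)^(-n-2) of the twice derived algebraic part.
   The remnants of the logarithm also become polynomials, and the half-integral power of z moves to
   the elliptic part, where it is harmless. *)
apply (Zb_mult 0 1 _ (fun z => Rpower z (3 / 2) * Rpower (1 - z) (n + 2))).
{ apply smooth_Derive, smooth_Derive, Sf. }
{ apply smooth_mult; [apply smooth_Rpower | apply smooth_Rpower_1m]. }
{ intros; apply Rpower_mult_neq_0. }
destruct He2 as (C2 & D2 & HC2 & HD2 & Ee2).
destruct Hp2 as (P2 & HP2 & Ep2).
destruct Hb1 as (B2 & HB2 & Eb1).
apply (Zb_elliptic_plus_pz (S (S (S (S N)))) (- / 2) 0 (S (S (S N))) _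
  (fun z => Rpower z (- / 2) * Rpower (1 - z) 0 * (C2 z * KU z + D2 z * KV z))
  (fun z => P2 z + (c * ((1 - z) ^ S N * z) + (1 - z) ^ N * B2 z))).
- intros z Hz; rewrite <- E2, Ee2, Ep2, Eb1 by exact Hz; unfold w0.
  set (W := Rpower z (3 / 2) * Rpower (1 - z) (n + 2)).
  assert (F : forall l m l' k, l' = 3 / 2 + l -> n + 2 + m = INR k ->
    W * (Rpower z l * Rpower (1 - z) m) = Rpower z l' * (1 - z) ^ k).
  { intros l m l' k -> Hm; rewrite <- (Rpower_pow k (1 - z)), <- Hm by lra.
    unfold W; rewrite !Rpower_plus; ring. }
  match goal with |- W * (?w1 * ?u1 + ?w2 * ?u2 + (c * ?w3 + ?w4 * ?u4)) = _ =>
    transitivity ((W * w1) * u1 + (W * w2) * u2 + (c * (W * w3) + (W * w4) * u4)); [ring|] end.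
  rewrite (F _ _ (- / 2) 0%nat), (F _ _ 0 0%nat), (F _ _ 1 (S N)), (F _ _ 0 N);
    rewrite ?S_INR; fold n; simpl INR; try lra.
  rewrite !Rpower_O, Rpower_1 by lra; rewrite pow_O; ring.
- exists C2, D2; auto.
- apply pz_plus; [exact HP2|apply pz_plus].
  + apply pz_scal, (pz_le (2 + S N)); [lia | apply pz_1mX_pow, pz_id].
  + apply (pz_le (3 + N)); [lia | apply pz_1mX_pow, HB2].
Qed.

Lemma smooth_shift a b c f : smooth a b f -> smooth (a - c) (b - c) (fun x => f (x + c)).
Proof.
intros Hf n; revert f Hf; induction n as [|n IH]; intros f Hf; [exact I|].
apply (Cn_intro _ _ n _ (fun x => Derive f (x + c))); [|apply IH, smooth_Derive, Hf].
intros x Hx; evar_last.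
- apply (is_derive_comp f (fun x => x + c)).
  + apply (smooth_is_derive a b); [exact Hf | lra].
  + auto_derive; [exact I | reflexivity].
- apply Rmult_1_l.
Qed.

Lemma van_shift m c f t : van m (fun x => f (x + c)) t <-> van m f (t + c).
Proof.
rewrite !van_Derive_n; split; intros H k Hk.
- rewrite <- Derive_n_comp_trans; apply H, Hk.
- rewrite Derive_n_comp_trans; apply H, Hk.
Qed.

Lemma zl_shift b c f lo l : zl (b - c) (fun x => f (x + c)) lo l ->
  zl b f (lo + c) (map (fun p => (fst p + c, snd p)) l).
Proof.
revert lo; induction l as [|[t m] l IH]; intros lo; [trivial|].
intros (H1 & H2 & H3); split; [simpl; lra|split].
- apply van_shift, H2.
- apply (IH t), H3.
Qed.

Lemma Zb_shift a b c f k : Zb a b f k -> Zb (a - c) (b - c) (fun x => f (x + c)) k.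
Proof.
intros [Z|N]; [left; intros x Hx; apply Z; lra|right].
intros l Hl; apply zl_shift in Hl; replace (a - c + c) with a in Hl by ring.
specialize (N _ Hl); unfold weight in *; rewrite map_map in N; exact N.
Qed.

Lemma melnikov_zeros N n ap bp am bm M : (n <= N + 3)%nat ->
  (forall h, -1 < h < 0 -> is_melnikov n ap bp am bm h (M h)) ->
  isolated_zeros_le M (-1) 0 (7 * N + 32).
Proof.
intros Hn HM.
destruct (melnikov_class_zeros N _ (melnikov_in_class N n ap bp am bm M Hn HM)) as [Sm Z].
apply (smooth_shift _ _ 1) in Sm; apply (Zb_shift _ _ 1) in Z; cbv beta in Sm, Z.
replace (0 - 1) with (-1) in Sm, Z by ring; replace (1 - 1) with 0 in Sm, Z by ring.
assert (E : forall x, -1 < x < 0 -> M (x + 1 - 1) = M x) by (intros; f_equal; ring).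
apply Zb_isolated_zeros_le.
- apply (smooth_ext (-1) 0 _ _ E Sm).
- apply (Zb_ext (-1) 0 _ _ _ E Z).
Qed.

Theorem theorem1p1 (n : nat) (hn : (2 <= n)%nat)
  (ap bp am bm : nat -> nat -> R) (M : R -> R)
  (hM : forall h, -1 < h < 0 -> is_melnikov n ap bp am bm h (M h)) :
  ((n = 2 \/ n = 3)%nat -> isolated_zeros_le M (-1) 0 40) /\
  ((4 <= n <= 7)%nat -> isolated_zeros_le M (-1) 0 (24 * n - 56)) /\
  ((8 <= n)%nat -> isolated_zeros_le M (-1) 0 (22 * n - 64)).
Proof.
assert (H : isolated_zeros_le M (-1) 0 (7 * (n - 3) + 32)).
(* Truncated subtraction gives N = 0 for n = 2, which still satisfies n <= N + 3. *)
{ apply (melnikov_zeros (n - 3) n ap bp am bm); [lia | exact hM]. }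
split; [|split]; intro Hn; refine (isolated_zeros_le_mono _ _ _ _ _ _ H); lia.
Qed.
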